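(* Let $p>1$ and let $U,V>0$ be a solution of $$|U'|^{p-2}U''=V^pU^{p-1},\qquad |V'|^{p-2}V''=U^pV^{p-1}\qquad\text{on }\mathbb R .$$ Let $T_\infty$ denote the constant value of $|U'|^p+|V'|^p-U^pV^p$ on $\mathbb R$. Then, up to exchanging $U$ and $V$, the following hold. 1) Up to translation, $V(y)=U(-y)$; that is, there is $x_0\in\mathbb R$ such that $V(x_0+y)=U(x_0-y)$ for all $y\in\mathbb R$. 2) $U'>0$ everywhere, $\lim_{x\to+\infty}U'(x)=T_\infty^{1/p}$, and there exist positive constants $m,M,k,K,c,C$ such that for $x$ near $-\infty$, $$m e^{-Kx^2}\le U(x)\le M e^{-kx^2},\qquad c|x|U(x)\le U'(x)\le C|x|U(x).$$ Symmetric properties hold for $V$ with $-\infty$ and $+\infty$ exchanged: $V'<0$ everywhere, $\lim_{x\to-\infty}V'(x)=-T_\infty^{1/p}$, and there are positive constants such that for $x$ near $+\infty$, $m e^{-Kx^2}\le V(x)\le M e^{-kx^2}$ and $c|x|V(x)\le -V'(x)\le C|x|V(x)$. 3) If $(\phi,\psi)$ is a bounded solution on $\mathbb R$ of the linearized system $$\left\{\begin{array}{l} (|U'|^{p-2}\phi')'=(p-1)U^{p-2}V^p\phi+pV^{p-1}U^{p-1}\psi,\\ (|V'|^{p-2}\psi')'=(p-1)V^{p-2}U^p\psi+pU^{p-1}V^{p-1}\phi, \end{array}\right.$$ then there exists a constant $c$ such that $(\phi,\psi)=c\,(U',V')$.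
   Context: Convention: for a $C^1$ function $w$ of one variable, $|w'|^{p-2}w''$ is understood as $\frac1{p-1}\,(|w'|^{p-2}w')'$ (this fixes the meaning at points where $w'=0$). For any solution of the system the quantity $|U'|^p+|V'|^p-U^pV^p$ is constant on $\mathbb R$. *)

(* Defs.v *)
From HB Require Import structures.
From mathcomp Require Import all_boot all_order all_algebra.
From mathcomp Require Import all_classical all_reals all_analysis.

Set Implicit Arguments.
Unset Strict Implicit.
Unset Printing Implicit Defensive.

Import Order.TTheory GRing.Theory Num.Theory.
Import numFieldNormedType.Exports.

Local Open Scope classical_set_scope.
Local Open Scope ring_scope.

Definition C1 (R : realType) (w : R -> R) : Prop :=
  (forall x, derivable w x 1) /\ continuous (derive1 w).

(* |w'|^(p-2) phi'.  When p > 1 and phi = w, the library's values 0 `^ a = 0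
   (a != 0) and 0 `^ 0 = 1 make this equal to 0 wherever w' vanishes, which is
   the continuous extension of |w'|^(p-2) w'. *)
Definition flux (R : realType) (p : R) (w phi : R -> R) (x : R) : R :=
  `|derive1 w x| `^ (p - 2) * derive1 phi x.

(* |w'|^(p-2) w'', understood as (|w'|^(p-2) w')' / (p - 1), so that it is
   meaningful where w' = 0. *)
Definition plap (R : realType) (p : R) (w : R -> R) (x : R) : R :=
  (p - 1)^-1 * derive1 (flux p w w) x.

Definition half_solution (R : realType) (p : R) (U V : R -> R) : Prop :=
  [/\ C1 U,
      forall x, derivable (flux p U U) x 1 &
      forall x, plap p U x = V x `^ p * U x `^ (p - 1)].

Definition system_solution (R : realType) (p : R) (U V : R -> R) : Prop :=
  half_solution p U V /\ half_solution p V U.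

Definition energy (R : realType) (p : R) (U V : R -> R) (x : R) : R :=
  `|derive1 U x| `^ p + `|derive1 V x| `^ p - U x `^ p * V x `^ p.

Definition half_linearized (R : realType) (p : R) (U V phi psi : R -> R) :
    Prop :=
  [/\ forall x, derivable phi x 1,
      forall x, derivable (flux p U phi) x 1 &
      forall x, derive1 (flux p U phi) x =
        (p - 1) * U x `^ (p - 2) * V x `^ p * phi x
        + p * V x `^ (p - 1) * U x `^ (p - 1) * psi x].

Definition linearized_solution (R : realType) (p : R) (U V phi psi : R -> R) :
    Prop :=
  half_linearized p U V phi psi /\ half_linearized p V U psi phi.

(* Used with F = -oo and df = U', and with F = +oo, f = V and df = - V'. *)
Definition gaussian_decay (R : realType) (F : set_system R) (f df : R -> R) :
    Prop :=
  exists m M k K c C : R,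
    [/\ 0 < m, 0 < M, 0 < k & 0 < K] /\ 0 < c /\ 0 < C /\
    \forall x \near F,
      (m * expR (- (K * x ^+ 2)) <= f x <= M * expR (- (k * x ^+ 2))) /\
      (c * `|x| * f x <= df x <= C * `|x| * f x).

Definition reflected (R : realType) (U V : R -> R) : Prop :=
  exists x0 : R, forall y, V (x0 + y) = U (x0 - y).

Definition asymptotics (R : realType) (p T : R) (U V : R -> R) : Prop :=
  [/\ forall x, 0 < derive1 U x,
      derive1 U x @[x --> +oo] --> T `^ (p^-1) &
      gaussian_decay -oo U (derive1 U)] /\
  [/\ forall x, derive1 V x < 0,
      derive1 V x @[x --> -oo] --> - (T `^ (p^-1)) &
      gaussian_decay +oo V (fun x => - derive1 V x)].

Definition linear_nondegeneracy (R : realType) (p : R) (U V : R -> R) : Prop :=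
  forall phi psi : R -> R,
    bounded_fun phi -> bounded_fun psi ->
    linearized_solution p U V phi psi ->
    exists c : R, forall x, phi x = c * derive1 U x /\ psi x = c * derive1 V x.

(* Main.v *)
(* If U' and V' were both nonnegative at a point, the two components would double
   in shorter and shorter times and blow up; by reflection they are never both
   nonpositive either, so U' and V' have constant opposite signs, say U' > 0 > V'.
   Put P = U' and Q = - V'. At +oo, P is bounded and U is linear, while a
   comparison of p-th powers gives U V <= Q and the monotonicity of
   Q^(p-1) - 2 (U V)^(p-1) gives Q <= C U V; hence V' is comparable to - x V, which
   is the Gaussian decay. For the symmetry, translate so that U(0) = V(0) and
   compare (U, V) with its reflection (V(-x), U(-x)): if U'(0) differed from
   - V'(0), the difference of the second components would increase from 0 although
   both tend to 0; so the Cauchy data coincide. For the linearized system, the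
   quotients a = phi / U' and b = psi / V' satisfy (P^p a')' = k (a - b) and
   (Q^p b')' = k (b - a) with k > 0, so P^p a a' + Q^p b b' is nondecreasing;
   boundedness of (phi, psi) makes it nonpositive near +oo and, by reflection,
   nonnegative near -oo, so it vanishes, and a = b is constant. *)

Require Import Defs.
From mathcomp Require Import all_boot all_order all_algebra.
From mathcomp Require Import all_classical all_reals all_analysis.
From mathcomp Require Import ring lra.

Set Implicit Arguments.
Unset Strict Implicit.
Unset Printing Implicit Defensive.

Import Order.TTheory GRing.Theory Num.Theory.
Import numFieldNormedType.Exports.

Local Open Scope classical_set_scope.
Local Open Scope ring_scope.

Local Notation D f x l := (is_derive (x : _) 1 f l).

(** * Differential calculus on the line *)

Section Calculus.
Context {R : realType}.
Implicit Types (f g h : R -> R) (x y l m a b c : R).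

(** Separates building a derivative by the rules below from simplifying its value, which becomes a
    purely algebraic goal. *)
Lemma Deq f x l m : D f x l -> l = m -> D f x m.
Proof. by move=> H <-. Qed.

Lemma Dder f x l : D f x l -> derive1 f x = l.
Proof. by move=> H; rewrite derive1E; exact: derive_val. Qed.

Lemma derD f x : derivable f x 1 -> D f x (derive1 f x).
Proof. by move=> /derivableP H; rewrite derive1E. Qed.

Lemma Dc c x : D (fun=> c : R) x 0.
Proof. exact: is_derive_cst. Qed.

Lemma Did x : D (fun y => y) x 1.
Proof. exact: is_derive_id. Qed.

Lemma Dadd f g x l m : D f x l -> D g x m -> D (fun y => f y + g y) x (l + m).
Proof. by move=> F G; exact: is_deriveD. Qed.

Lemma Dopp f x l : D f x l -> D (fun y => - f y) x (- l).
Proof. by move=> F; exact: is_deriveN. Qed.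

Lemma Dsub f g x l m : D f x l -> D g x m -> D (fun y => f y - g y) x (l - m).
Proof. by move=> F G; exact: is_deriveB. Qed.

Lemma Dmul f g x l m :
  D f x l -> D g x m -> D (fun y => f y * g y) x (f x * m + g x * l).
Proof. by move=> F G; exact: is_deriveM. Qed.

Lemma Dscale c f x l : D f x l -> D (fun y => c * f y) x (c * l).
Proof. by move=> F; apply: Deq (Dmul (Dc c x) F) _; rewrite mulr0 addr0. Qed.

Lemma Dsqr f x l : D f x l -> D (fun y => f y ^+ 2) x (2 * f x * l).
Proof.
move=> F; have -> : (fun y => f y ^+ 2) = (fun y => f y * f y) by [].
by apply: Deq (Dmul F F) _; ring.
Qed.

Lemma Dcomp f g x l m : D g x m -> D f (g x) l -> D (fun y => f (g y)) x (l * m).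
Proof. by move=> G F; apply: Deq (is_derive1_comp F G) _; rewrite mulrC. Qed.

Lemma Dflip f x l : D f (- x) l -> D (fun y => f (- y)) x (- l).
Proof.
move=> F; apply: Deq (Dcomp (Dopp (Did x)) F) _.
by rewrite mulrN1.
Qed.

Lemma Dshift f a x l : D f (a + x) l -> D (fun y => f (a + y)) x l.
Proof.
move=> F; apply: Deq (Dcomp (Dadd (Dc a x) (Did x)) F) _.
by rewrite add0r mulr1.
Qed.

Lemma Dinv f x l : f x != 0 -> D f x l -> D (fun y => (f y)^-1) x (- l / f x ^+ 2).
Proof.
move=> f0 F; apply: Deq (is_deriveV f0 F) _.
by rewrite /GRing.scale /= mulNr mulrC mulNr.
Qed.

Lemma Ddiv f g x l m : g x != 0 -> D f x l -> D g x m ->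
  D (fun y => f y / g y) x ((l * g x - f x * m) / g x ^+ 2).
Proof.
move=> g0 F G; apply: Deq (Dmul F (Dinv g0 G)) _.
by field.
Qed.

(** The derivative is written with f^r / f instead of f^(r-1), so that f^r is the only power
    occurring and [field] can treat it as an atom. *)
Lemma Dpow r f x l : 0 < f x -> D f x l ->
  D (fun y => f y `^ r) x (r * f x `^ r / f x * l).
Proof.
move=> f0 F; apply: Deq (Dcomp F (is_derive1_powR r f0)) _.
rewrite powRB; last by rewrite (gt_eqF f0) implybT.
by rewrite powRr1 ?ltW// mulrA.
Qed.

Lemma Dexp f x l : D f x l -> D (fun y => expR (f y)) x (expR (f x) * l).
Proof. by move=> F; exact: Dcomp F (is_derive_expR _). Qed.

Lemma Dcont f x l : D f x l -> {for x, continuous f}.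
Proof.
by case=> H _; apply: differentiable_continuous; apply/derivable1_diffP.
Qed.

Lemma Dcontinuous f h : (forall x, D f x (h x)) -> continuous f.
Proof. by move=> H x; apply: (Dcont (H x)). Qed.

Lemma Dmvt f h a b : (forall x, D f x (h x)) -> a < b ->
  exists2 c, a < c < b & f b - f a = h c * (b - a).
Proof.
move=> H ab; have [|c] := MVT ab (fun x _ => H x).
- by apply: continuous_subspaceT; exact: Dcontinuous H.
- by rewrite in_itv /= => cab E; exists c.
Qed.

Lemma Dle f h a b : (forall x, D f x (h x)) -> a <= b ->
  (forall x, a < x < b -> 0 <= h x) -> f a <= f b.
Proof.
move=> H; rewrite le_eqVlt => /orP[/eqP-> //|ab] h0.
have [c cab E] := Dmvt H ab.
by rewrite -subr_ge0 E mulr_ge0 ?h0// subr_ge0 ltW.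
Qed.

Lemma Dge f h a b : (forall x, D f x (h x)) -> a <= b ->
  (forall x, a < x < b -> h x <= 0) -> f b <= f a.
Proof.
move=> H ab h0.
rewrite -lerN2; apply: (Dle (f := fun x => - f x) (fun x => Dopp (H x)) ab).
by move=> x /h0; rewrite oppr_ge0.
Qed.

Lemma Dlt f h a b : (forall x, D f x (h x)) -> a < b ->
  (forall x, a < x < b -> 0 < h x) -> f a < f b.
Proof.
move=> H ab h0; have [c cab E] := Dmvt H ab.
by rewrite -subr_gt0 E mulr_gt0 ?h0// subr_gt0.
Qed.

Lemma Dle_lin f h a b c : (forall x, D f x (h x)) -> a <= b ->
  (forall x, a < x < b -> c <= h x) -> f a + c * (b - a) <= f b.
Proof.
move=> H ab hc.
have: f a - c * a <= f b - c * b.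
  apply: (Dle (f := fun x => f x - c * x)
            (fun x => Dsub (H x) (Dscale c (Did x))) ab) => x /hc.
  by rewrite mulr1 subr_ge0.
lra.
Qed.

Lemma Dge_lin f h a b c : (forall x, D f x (h x)) -> a <= b ->
  (forall x, a < x < b -> h x <= c) -> f b <= f a + c * (b - a).
Proof.
move=> H ab hc.
have := Dle_lin (c := - c) (fun x => Dopp (H x)) ab.
move=> /(_ _); rewrite /= => W.
have: - f a + - c * (b - a) <= - f b.
  by apply: W => x /hc; rewrite lerN2.
lra.
Qed.

Lemma Dconst f h : (forall x, D f x (h x)) -> (forall x, h x = 0) ->
  forall x y, f x = f y.
Proof.
move=> H h0 x y; wlog xy : x y / x <= y.
  by move=> W; case: (lerP x y) => [/W //|/ltW /W].
apply/eqP; rewrite eq_le; apply/andP; split.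
- by apply: (Dle H xy) => z _; rewrite h0.
- by apply: (Dge H xy) => z _; rewrite h0.
Qed.

(* Continuous induction on [a, +oo[: at the infimum t of the points where
   f <= 0, the hypothesis gives f t > 0, hence f > 0 slightly beyond t. *)
Lemma continuation f a : continuous f -> 0 < f a ->
  (forall t, a < t -> (forall s, a <= s < t -> 0 < f s) -> 0 < f t) ->
  forall t, a <= t -> 0 < f t.
Proof.
move=> cf fa H t at_; rewrite ltNge; apply/negP => ft.
pose S := [set s | a <= s /\ f s <= 0].
have hS : has_inf S.
  by split; [exists t|exists a => s []].
have lowS s : S s -> inf S <= s by move=> Ss; apply: ge_inf => //; exact: hS.2.
have aS : a <= inf S by apply: lb_le_inf; [exact: hS.1|move=> s []].
have fS : 0 < f (inf S).
  move: aS; rewrite le_eqVlt => /orP[/eqP<- //|aS].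
  apply: H => // s /andP[as_ sS]; rewrite ltNge; apply/negP => fs.
  by have := lowS s (conj as_ fs); rewrite leNgt sS.
have : \forall s \near inf S, 0 < f s.
  have := cf (inf S) => /cvgr_gt; exact.
case/nbhs_ballP => e /= e0 He.
have [s Ss sS] := inf_adherent e0 hS.
have := lowS s Ss => Ssle.
have : 0 < f s.
  apply: He; rewrite /ball /= ltr_norml; apply/andP; split; lra.
by case: Ss => _; rewrite leNgt => /negP.
Qed.

(** Otherwise h <= 0 wherever f > c; going from b to the left, f would never decrease, hence stay
    above c down to a. *)
Lemma rise_point f h a b c : (forall x, D f x (h x)) -> a <= b ->
  f a <= c -> c < f b -> exists x, [/\ a <= x <= b, c < f x & 0 < h x].
Proof.
move=> H ab fac fbc; apply: contrapT => NE.
have h0 x : a <= x <= b -> c < f x -> h x <= 0.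
  by move=> xab cx; rewrite leNgt; apply/negP => hx; apply: NE; exists x.
have Dg x : D (fun t => f (- t) - c) x (- h (- x)).
  by apply: Deq (Dsub (Dflip (H (- x))) (Dc c x)) _; rewrite subr0.
pose k t := f (- t) - c.
have K : continuous (fun t => Num.max (k t) (t + a)).
  move=> t; apply: (@continuous_max _ _ k (fun t => t + a)).
    exact: Dcontinuous Dg t.
  exact: Dcont (Dadd (Did t) (Dc a t)).
have kb : 0 < Num.max (k (- b)) (- b + a).
  by rewrite lt_max /k opprK subr_gt0 fbc.
(* In the reversed time t = -x the claim only concerns t <= -a. The term t + a makes the maximum
   positive beyond -a and vanishes at -a, so [continuation] applies on a half-line and its value at
   -a still gives f a > c. *)
suff W : forall t, - b <= t -> 0 < Num.max (k t) (t + a).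
  have := W (- a); rewrite lerN2 lt_max /k opprK addNr ltxx orbF => /(_ ab).
  by rewrite subr_gt0 ltNge fac.
apply: (continuation K kb) => u bu Hu; rewrite lt_max.
case: (ltrP 0 (u + a)) => [|ua]; first by rewrite orbT.
rewrite orbF.
have kpos s : - b <= s < u -> 0 < k s.
  by move=> sbu; have := Hu s sbu; rewrite lt_max => /orP[//|]; lra.
have : k (- b) <= k u.
  apply: (Dle Dg (ltW bu)) => s /andP[bs su]; rewrite oppr_ge0.
  have := kpos s; rewrite /k subr_gt0 => cfs.
  by apply: h0; [lra | apply: cfs; rewrite (ltW bs) su].
by rewrite /k opprK; lra.
Qed.

End Calculus.

(** * Powers and functions tending to zero *)

Section Powers.
Context {R : realType}.
Implicit Types (a b c q : R).

Lemma pow_le q a b : 0 < q -> 0 <= a -> a <= b -> a `^ q <= b `^ q.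
Proof.
move=> q0 a0 ab; apply: ge0_ler_powR; rewrite ?nnegrE ?(ltW q0)//.
exact: le_trans ab.
Qed.

Lemma pow_lt q a b : 0 < q -> 0 <= a -> a < b -> a `^ q < b `^ q.
Proof.
move=> q0 a0 ab; apply: gt0_ltr_powR; rewrite ?nnegrE//.
exact: le_trans a0 (ltW ab).
Qed.

Lemma pow_lt_inv q a b : 0 < q -> 0 <= b -> a `^ q < b `^ q -> a < b.
Proof.
by move=> q0 b0; apply: contraTT; rewrite -!leNgt; exact: pow_le.
Qed.

Lemma pow_le_inv q a b : 0 < q -> 0 <= a -> 0 <= b -> a `^ q <= b `^ q -> a <= b.
Proof.
by move=> q0 a0 b0; apply: contraTT; rewrite -!ltNge; exact: pow_lt.
Qed.

Lemma pow1p q a : 0 < a -> a `^ (q + 1) = a * a `^ q.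
Proof.
move=> a0; rewrite powRD ?(gt_eqF a0) ?implybT// powRr1 1?mulrC//; exact: ltW.
Qed.

Lemma pow1m q a : 0 < a -> a `^ (q - 1) = a `^ q / a.
Proof. by move=> a0; rewrite powRB ?(gt_eqF a0) ?implybT// powRr1// ltW. Qed.

Lemma pow_inv q a : q != 0 -> 0 <= a -> (a `^ q) `^ q^-1 = a.
Proof. by move=> q0 a0; rewrite -powRrM mulfV// powRr1. Qed.

Lemma pow_invr q a : q != 0 -> 0 <= a -> (a `^ q^-1) `^ q = a.
Proof. by move=> q0 a0; rewrite -powRrM mulVf// powRr1. Qed.

Lemma pow1_le q a b : 0 < q -> 0 < a -> a <= b -> a * a `^ q <= b * b `^ q.
Proof.
move=> q0 a0 ab; apply: ler_pM => //; [exact: ltW|exact: powR_ge0|].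
by apply: pow_le => //; exact: ltW.
Qed.

(** A one-sided notion: for f >= 0 it means convergence to 0 at +oo, in general only that the upper
    limit there is at most 0. *)
Definition small (f : R -> R) :=
  forall e, 0 < e -> exists A, forall x, A <= x -> f x < e.

Lemma small_div (f : R -> R) c :
  (forall x, 0 <= x -> f x * x <= c) -> small f.
Proof.
move=> H e e0; exists (`|c| / e + 1) => x hx.
have c0 : 0 <= `|c| / e by rewrite divr_ge0// ltW.
have x0 : 0 < x by lra.
rewrite -(ltr_pM2r x0); apply: le_lt_trans (H _ (ltW x0)) _.
apply: le_lt_trans (ler_norm c) _.
by rewrite mulrC -ltr_pdivrMr//; lra.
Qed.

Lemma small_le (f g : R -> R) A :
  (forall x, A <= x -> f x <= g x) -> small g -> small f.
Proof.
move=> fg sg e /sg[B HB]; exists (Num.max A B) => x.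
by rewrite ge_max => /andP[Ax Bx]; exact: le_lt_trans (fg x Ax) (HB x Bx).
Qed.

Lemma small_pow q (f : R -> R) : 0 < q -> (forall x, 0 <= f x) ->
  small f <-> small (fun x => f x `^ q).
Proof.
move=> q0 f0; split => sf e e0.
  have [A HA] := sf _ (powR_gt0 q^-1 e0).
  exists A => x /HA fe; have := pow_lt q0 (f0 x) fe.
  by rewrite pow_invr ?gt_eqF ?ltW.
have [A HA] := sf _ (powR_gt0 q e0).
by exists A => x /HA; apply: pow_lt_inv => //; exact: ltW.
Qed.

Lemma small_nonneg (f : R -> R) c A : small f -> (forall x, A <= x -> c <= f x) ->
  c <= 0.
Proof.
move=> sf H; rewrite leNgt; apply/negP => c0.
have [B HB] := sf c c0.
have := HB (Num.max A B); rewrite le_max lexx orbT => /(_ isT).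
by rewrite ltNge H// le_max lexx.
Qed.

End Powers.

(** * Solutions with U' > 0 > V' *)

Section MonotoneSolutions.
Context {R : realType}.
Implicit Types (q x y : R) (U V P Q : R -> R).

(* The system with p = q + 1, P = U' > 0 and Q = - V' > 0. *)
Record msol q U V P Q : Prop := Msol {
  msol_q : 0 < q;
  msol_U : forall x, 0 < U x;
  msol_V : forall x, 0 < V x;
  msol_P : forall x, 0 < P x;
  msol_Q : forall x, 0 < Q x;
  msol_dU : forall x, D U x (P x);
  msol_dV : forall x, D V x (- Q x);
  msol_dP : forall x, D P x (V x * V x `^ q * U x `^ q * P x / P x `^ q);
  msol_dQ : forall x, D Q x (- (U x * U x `^ q * V x `^ q * Q x / Q x `^ q)) }.

(** Reflection exchanges the increasing and the decreasing component, so facts proved at +oo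
    transfer to -oo. *)
Lemma msol_flip q U V P Q : msol q U V P Q ->
  msol q (fun x => V (- x)) (fun x => U (- x)) (fun x => Q (- x)) (fun x => P (- x)).
Proof.
case=> q0 U0 V0 P0 Q0 dU dV dP dQ; split => // x.
- by apply: Deq (Dflip (dV (- x))) _; rewrite opprK.
- exact: Dflip (dU (- x)).
- by apply: Deq (Dflip (dQ (- x))) _; rewrite opprK.
- exact: Dflip (dP (- x)).
Qed.

Lemma msol_shift q U V P Q a : msol q U V P Q ->
  msol q (fun x => U (a + x)) (fun x => V (a + x)) (fun x => P (a + x))
    (fun x => Q (a + x)).
Proof.
by case=> q0 U0 V0 P0 Q0 dU dV dP dQ; split => // x; apply: Dshift.
Qed.

Context {q : R} {U V P Q : R -> R}.
Hypothesis S : msol q U V P Q.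

Let q0 := msol_q S.
Let U0 := msol_U S.
Let V0 := msol_V S.
Let P0 := msol_P S.
Let Q0 := msol_Q S.
Let Uq0 x : 0 < U x `^ q := powR_gt0 q (U0 x).
Let Vq0 x : 0 < V x `^ q := powR_gt0 q (V0 x).
Let Pq0 x : 0 < P x `^ q := powR_gt0 q (P0 x).
Let Qq0 x : 0 < Q x `^ q := powR_gt0 q (Q0 x).

Lemma msol_dUq x : D (fun t => U t `^ q) x (q * U x `^ q / U x * P x).
Proof. exact: Dpow (U0 x) (msol_dU S x). Qed.

Lemma msol_dVq x : D (fun t => V t `^ q) x (- (q * V x `^ q / V x * Q x)).
Proof. by apply: Deq (Dpow q (V0 x) (msol_dV S x)) _; rewrite mulrN. Qed.

Lemma msol_dPq x : D (fun t => P t `^ q) x (q * (V x * V x `^ q * U x `^ q)).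
Proof.
apply: Deq (Dpow q (P0 x) (msol_dP S x)) _; field.
by rewrite !gt_eqF.
Qed.

Lemma msol_dQq x : D (fun t => Q t `^ q) x (- (q * (U x * U x `^ q * V x `^ q))).
Proof.
apply: Deq (Dpow q (Q0 x) (msol_dQ S x)) _; field.
by rewrite !gt_eqF.
Qed.

Lemma msol_U_le x y : x <= y -> U x <= U y.
Proof. by move=> xy; apply: (Dle (msol_dU S) xy) => z _; exact: ltW. Qed.

Lemma msol_V_le x y : x <= y -> V y <= V x.
Proof.
by move=> xy; apply: (Dge (msol_dV S) xy) => z _; rewrite oppr_le0; exact: ltW.
Qed.

Lemma msol_P_le x y : x <= y -> P x <= P y.
Proof.
by move=> xy; apply: (Dle (msol_dP S) xy) => z _; rewrite !(mulr_ge0, invr_ge0)// ltW.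
Qed.

Lemma msol_Q_le x y : x <= y -> Q y <= Q x.
Proof.
move=> xy; apply: (Dge (msol_dQ S) xy) => z _.
by rewrite oppr_le0 !(mulr_ge0, invr_ge0)// ltW.
Qed.

(** The derivatives of P^p and Q^p are p P U^q V^p and -p Q U^p V^q, and their sum is the derivative
    of U^p V^p. *)
Lemma msol_energy : exists T, forall x,
  P x * P x `^ q + Q x * Q x `^ q - U x * U x `^ q * (V x * V x `^ q) = T.
Proof.
pose E x := P x * P x `^ q + Q x * Q x `^ q - U x * U x `^ q * (V x * V x `^ q).
exists (E 0) => x.
apply: (Dconst (f := E) (fun x =>
  Dsub (Dadd (Dmul (msol_dP S x) (msol_dPq x)) (Dmul (msol_dQ S x) (msol_dQq x)))
    (Dmul (Dmul (msol_dU S x) (msol_dUq x)) (Dmul (msol_dV S x) (msol_dVq x))))).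
by move=> y; field; rewrite !gt_eqF.
Qed.

(** Since Q = -V' is nonincreasing, V loses at least x Q(x) on [0, x] while remaining positive; thus
    x Q(x) <= V(0). *)
Lemma msol_Q_small : small Q.
Proof.
apply: (@small_div _ Q (V 0)) => x x0.
have H : V x <= V 0 + - Q x * (x - 0).
  apply: (Dge_lin (msol_dV S) x0) => y /andP[_ /ltW yx].
  by rewrite lerN2; exact: msol_Q_le.
by have := V0 x; lra.
Qed.

(** On [0, x] the derivative of Q^q is at most -q U(0)^p V(x)^q, and Q^q stays positive; thus x
    V(x)^q is bounded. *)
Lemma msol_V_small : small V.
Proof.
apply/(small_pow q0 (fun x => ltW (V0 x))).
apply: (@small_div _ _ (Q 0 `^ q / (q * (U 0 * U 0 `^ q)))) => x x0.
rewrite ler_pdivlMr ?mulr_gt0//.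
have H : Q x `^ q <= Q 0 `^ q + - (q * (U 0 * U 0 `^ q) * V x `^ q) * (x - 0).
  apply: (Dge_lin msol_dQq x0) => y /andP[/ltW y0 /ltW yx].
  rewrite lerN2 -mulrA ler_pM2l//.
  apply: ler_pM; [by rewrite mulr_ge0 ?ltW|exact: ltW| |].
    by apply: pow1_le => //; exact: msol_U_le.
  by apply: pow_le => //; [exact: ltW|exact: msol_V_le].
by have := Qq0 x; rewrite subr0 in H; lra.
Qed.

(* y |-> Q(y)^p - U(x)^p V(y)^p is nonincreasing on [x, +oo[ and tends to 0. *)
Lemma msol_UV_le x : U x * V x <= Q x.
Proof.
rewrite leNgt; apply/negP => lt2.
have lt1 : Q x `^ q < U x `^ q * V x `^ q.
  by rewrite -powRM ?ltW//; apply: pow_lt => //; exact: ltW.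
pose f y := Q y * Q y `^ q - U x * U x `^ q * (V y * V y `^ q).
have fx : f x < 0.
  rewrite /f subr_lt0.
  have -> : U x * U x `^ q * (V x * V x `^ q) = (U x * V x) * (U x `^ q * V x `^ q).
    by ring.
  by apply: ltr_pM; rewrite ?ltW.
have fle y : x <= y -> f y <= f x.
  move=> xy; apply: (Dge (f := f) (fun y =>
   Dsub (Dmul (msol_dQ S y) (msol_dQq y))
    (Dscale (U x * U x `^ q) (Dmul (msol_dV S y) (msol_dVq y)))) xy).
  move=> z /andP[/ltW xz _].
  have -> : Q z * - (q * (U z * U z `^ q * V z `^ q)) +
      Q z `^ q * - (U z * U z `^ q * V z `^ q * Q z / Q z `^ q) -
      U x * U x `^ q * (V z * - (q * V z `^ q / V z * Q z) + V z `^ q * - Q z)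
    = (q + 1) * Q z * V z `^ q * (U x * U x `^ q - U z * U z `^ q).
    by field; rewrite !gt_eqF.
  rewrite mulr_ge0_le0//; first by rewrite !mulr_ge0// ?addr_ge0// ltW.
  by rewrite subr_le0; apply: pow1_le => //; exact: msol_U_le.
have K0 : 0 < U x * U x `^ q * V x `^ q by rewrite !mulr_gt0.
(* From f y <= f x < 0 it follows that U(x)^p V(y)^p >= - f x; with V(y)^q <= V(x)^q this bounds
   V(y) below by a positive constant, against its decay. *)
have : - f x / (U x * U x `^ q * V x `^ q) <= 0.
  apply: (small_nonneg (A := x) msol_V_small) => y xy.
  rewrite ler_pdivrMr//.
  have := fle y xy; rewrite {1}/f.
  have : 0 < Q y * Q y `^ q by rewrite mulr_gt0.
  have : U x * U x `^ q * (V y * V y `^ q) <= V y * (U x * U x `^ q * V x `^ q).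
    have -> : U x * U x `^ q * (V y * V y `^ q) = (V y * (U x * U x `^ q)) * V y `^ q.
      by ring.
    have -> : V y * (U x * U x `^ q * V x `^ q) = (V y * (U x * U x `^ q)) * V x `^ q.
      by ring.
    rewrite ler_pM2l ?mulr_gt0//.
    by apply: pow_le => //; [exact: ltW|exact: msol_V_le].
  lra.
by rewrite ler_pdivrMr// mul0r; lra.
Qed.

End MonotoneSolutions.

(** * Growth of U and decay of V at +oo *)

Section Decay.
Context {R : realType} {q : R} {U V P Q : R -> R}.
Hypothesis S : msol q U V P Q.

Let q0 := msol_q S.
Let U0 := msol_U S.
Let V0 := msol_V S.
Let P0 := msol_P S.
Let Q0 := msol_Q S.
Let Uq0 x : 0 < U x `^ q := powR_gt0 q (U0 x).
Let Vq0 x : 0 < V x `^ q := powR_gt0 q (V0 x).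
Let Qq0 x : 0 < Q x `^ q := powR_gt0 q (Q0 x).

Lemma msol_UVp_le x : U x * U x `^ q * (V x * V x `^ q) <= Q x * Q x `^ q.
Proof.
have := pow1_le q0 (mulr_gt0 (U0 x) (V0 x)) (msol_UV_le S x).
rewrite powRM; [|exact: ltW|exact: ltW].
by rewrite mulrACA.
Qed.

(** By [msol_UVp_le] the terms of the energy other than P^p have a nonnegative sum, so P^p <= T. *)
Lemma msol_P_bound : exists2 M, 0 < M & forall x, P x <= M.
Proof.
have [T ET] := msol_energy S.
exists (T `^ (q + 1)^-1).
  apply: powR_gt0; rewrite -(ET 0).
  have := msol_UVp_le 0.
  have := mulr_gt0 (P0 0) (powR_gt0 q (P0 0)).
  by lra.
have q1 : q + 1 != 0 by rewrite gt_eqF// addr_gt0.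
move=> x; rewrite -[P x](pow_inv q1 (ltW (P0 x))).
apply: pow_le; [by rewrite invr_gt0 addr_gt0|exact: powR_ge0|].
rewrite pow1p// -(ET x).
by have := msol_UVp_le x; lra.
Qed.

Lemma msol_U_linear : exists c C, [/\ 0 < c, 0 < C &
  forall x, 1 <= x -> c * x <= U x <= C * x].
Proof.
have [M M0 PM] := msol_P_bound.
exists (P 0), (U 0 + M); split; rewrite ?addr_gt0//.
move=> x x1; have x0 : 0 <= x by lra.
have H1 : U 0 + P 0 * (x - 0) <= U x.
  by apply: (Dle_lin (msol_dU S) x0) => y /andP[/ltW y0 _]; exact: msol_P_le S _ _ y0.
have H2 : U x <= U 0 + M * (x - 0).
  by apply: (Dge_lin (msol_dU S) x0).
have : U 0 <= U 0 * x by rewrite ler_peMr// ltW.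
by have := U0 0; lra.
Qed.

Lemma msol_U_large M : exists A, forall x, A <= x -> M <= U x.
Proof.
have [c [C [c0 C0 H]]] := msol_U_linear.
exists (Num.max 1 (M / c)) => x; rewrite ge_max => /andP[x1].
by rewrite ler_pdivrMr// => Mx; have /andP[] := H x x1; lra.
Qed.

(* Q^q - 2 (U V)^q is eventually nondecreasing and tends to 0. *)
Lemma msol_Qq_le : exists A, forall x, A <= x -> Q x `^ q <= 2 * (U x `^ q * V x `^ q).
Proof.
have [M M0 PM] := msol_P_bound.
(* Beyond A one has U >= 1 and U >= 2 M, hence U^2 >= 2 M >= 2 P. *)
have [A HA] := msol_U_large (2 * M + 1).
exists A; pose h x := Q x `^ q - 2 * (U x `^ q * V x `^ q).
have hle x y : A <= x -> x <= y -> h x <= h y.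
  move=> Ax xy; apply: (Dle (f := h) (fun x => Dsub (msol_dQq S x)
    (Dscale 2 (Dmul (msol_dUq S x) (msol_dVq S x)))) xy) => z /andP[/ltW xz _].
  (* The bracket is arranged so that both summands are nonnegative: the first by the choice of A,
     the second by U V <= Q. *)
  have -> : - (q * (U z * U z `^ q * V z `^ q)) -
     2 * (U z `^ q * - (q * V z `^ q / V z * Q z) +
          V z `^ q * (q * U z `^ q / U z * P z))
    = q * U z `^ q * V z `^ q / (U z * V z) *
      ((U z * U z - 2 * P z) * V z + 2 * (Q z - U z * V z) * U z).
    by field; rewrite !gt_eqF.
  apply: mulr_ge0; first by rewrite !(mulr_ge0, invr_ge0)// ltW.
  apply: addr_ge0; last by rewrite !mulr_ge0 ?subr_ge0 ?(msol_UV_le S)// ltW.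
  apply: mulr_ge0; last exact: ltW.
  have := HA z (le_trans Ax xz); have := PM z => h1 h2.
  have : (2 * M + 1) * 1 <= U z * U z by apply: ler_pM; lra.
  by lra.
have hs : small h.
  apply: (small_le (g := fun x => Q x `^ q) (A := 0)) => [x _|].
    by rewrite /h gerBl !mulr_ge0// ltW.
  by apply/(small_pow q0 (fun x => ltW (Q0 x))); exact: msol_Q_small S.
move=> x Ax.
have : h x <= 0.
  by apply: (small_nonneg (A := x) hs) => y; exact: hle.
by rewrite /h subr_le0.
Qed.

Lemma msol_Q_le_UV : exists C A, 0 < C /\
  forall x, A <= x -> Q x <= C * (U x * V x).
Proof.
have [A H] := msol_Qq_le.
exists (2 `^ q^-1), A; split; first exact: powR_gt0.
move=> x /H Hx; apply: (pow_le_inv q0).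
- exact: ltW.
- by rewrite !mulr_ge0 ?powR_ge0// ltW.
rewrite !powRM ?pow_invr ?gt_eqF// ?mulr_ge0 ?powR_ge0//; exact: ltW.
Qed.

(** From U V <= Q one gets U^p V^q <= U Q^q, and U^2 Q^q is eventually nonincreasing, so U Q^q is at
    most a constant over U. This controls the derivative of 1/Q, which is U^p V^q / Q^p. *)
Lemma msol_UpVq_small : small (fun x => U x * U x `^ q * V x `^ q).
Proof.
have [M M0 PM] := msol_P_bound.
have [A HA] := msol_Qq_le.
(* This threshold gives q U^2 >= 4 M >= 4 P. Once Q^q is replaced by 2 (U V)^q, the derivative of
   U^2 Q^q is bounded by U^p V^q (4 P - q U^2). *)
have [B HB] := msol_U_large (4 * M / q + 1).
pose X := Num.max A B.
have g_le x : X <= x -> U x ^+ 2 * Q x `^ q <= U X ^+ 2 * Q X `^ q.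
  move=> Xx; apply: (Dge (fun x => Dmul (Dsqr (msol_dU S x)) (msol_dQq S x)) Xx).
  move=> y /andP[/ltW Xy _].
  have [Ay By] : A <= y /\ B <= y by move: Xy; rewrite ge_max => /andP[].
  have h1 : Q y `^ q * (2 * U y * P y) <=
            2 * (U y `^ q * V y `^ q) * (2 * U y * P y).
    by rewrite ler_pM2r ?HA// !mulr_gt0.
  suff : U y * U y `^ q * V y `^ q * (4 * P y - q * U y ^+ 2) <= 0 by lra.
  rewrite mulr_ge0_le0//; first by rewrite !mulr_ge0// ltW.
  have := HB y By; have := PM y => h2 h3.
  have h4 : q * (4 * M / q + 1) = 4 * M + q by field; rewrite gt_eqF.
  have h5 : 0 <= 4 * M / q by rewrite !mulr_ge0// ?invr_ge0 ltW.
  have h6 : q * (4 * M / q + 1) * 1 <= q * U y * U y.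
    apply: ler_pM => //.
    - by rewrite h4 addr_ge0 ?mulr_ge0 ?(ltW M0) ?(ltW q0).
    - by rewrite ler_pM2l.
    - by apply: le_trans h3; lra.
  rewrite h4 mulr1 -mulrA -expr2 in h6.
  rewrite subr_le0; apply: (@le_trans _ _ (4 * M)); first by rewrite ler_pM2l.
  by apply: le_trans h6; rewrite lerDl ltW.
move=> e e0; pose C := U X ^+ 2 * Q X `^ q.
have C0 : 0 < C by rewrite mulr_gt0// exprn_gt0.
have [Y HY] := msol_U_large (C / e + 1).
exists (Num.max X Y) => x; rewrite ge_max => /andP[Xx Yx].
apply: (@le_lt_trans _ _ (U x * Q x `^ q)).
  rewrite -mulrA ler_pM2l// -powRM; [|exact: ltW|exact: ltW].
  apply: pow_le => //; last exact: msol_UV_le S x.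
  by rewrite mulr_ge0// ltW.
rewrite -(ltr_pM2l (U0 x)) mulrA -expr2; apply: le_lt_trans (g_le x Xx) _.
rewrite -ltr_pdivrMr//; apply: lt_le_trans (HY x Yx).
by rewrite /C; lra.
Qed.

(** Linear growth of U turns the comparison of Q with U V into c x V <= -V' <= B C x V; integrating
    this differential inequality gives the Gaussian bounds. *)
Lemma msol_V_decay : exists m M k K c C A : R,
  [/\ [/\ 0 < m, 0 < M, 0 < k & 0 < K], 0 < c, 0 < C &
  forall x, A <= x ->
    (m * expR (- (K * x ^+ 2)) <= V x <= M * expR (- (k * x ^+ 2))) /\
    (c * `|x| * V x <= Q x <= C * `|x| * V x)].
Proof.
have [c [C [c0 C0 HU]]] := msol_U_linear.
have [B [A [B0 HQ]]] := msol_Q_le_UV.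
pose A1 := Num.max 1 A.
have Hc x : A1 <= x -> c * x * V x <= Q x.
  rewrite ge_max => /andP[x1 _]; apply: le_trans (msol_UV_le S x).
  by rewrite ler_pM2r//; have /andP[] := HU x x1.
have HC x : A1 <= x -> Q x <= B * C * x * V x.
  rewrite ge_max => /andP[x1 Ax]; apply: le_trans (HQ x Ax) _.
  rewrite -!mulrA ler_pM2l// mulrA ler_pM2r//.
  by have /andP[] := HU x x1.
(* Beyond A1 this product is nondecreasing for a = B C and nonincreasing for a = c; the constants m
   and M below are its values at A1 for these two choices. *)
have dE (a x : R) : D (fun t => V t * expR (a / 2 * t ^+ 2)) x
    (expR (a / 2 * x ^+ 2) * (a * x * V x - Q x)).
  apply: Deq (Dmul (msol_dV S x) (Dexp (Dscale (a / 2) (Dsqr (Did x))))) _.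
  by field.
pose k := c / 2; pose K := B * C / 2.
pose m := V A1 * expR (K * A1 ^+ 2); pose M := V A1 * expR (k * A1 ^+ 2).
exists m, M, k, K, c, (B * C), A1.
rewrite !mulr_gt0 ?expR_gt0 ?invr_gt0//; split => // x Ax; split; last first.
  have x0 : 0 <= x by move: Ax; rewrite ge_max => /andP[]; lra.
  by rewrite ger0_norm// Hc// HC.
rewrite !expRN ler_pdivlMr ?expR_gt0// ler_pdivrMr ?expR_gt0//.
apply/andP; split.
  apply: (Dle (dE (B * C)) Ax) => y /andP[/ltW Ay _].
  by rewrite mulr_ge0 ?expR_ge0// subr_ge0 HC.
apply: (Dge (dE c) Ax) => y /andP[/ltW Ay _].
by rewrite mulr_ge0_le0 ?expR_ge0// subr_le0 Hc.
Qed.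

(** P^p is squeezed between T - Q^p and T, where Q tends to 0. Positivity of T makes the p-th root
    differentiable, hence continuous, at T. *)
Lemma msol_P_cvg T : (forall x,
  P x * P x `^ q + Q x * Q x `^ q - U x * U x `^ q * (V x * V x `^ q) = T) ->
  0 < T /\ P x @[x --> +oo] --> T `^ (q + 1)^-1.
Proof.
move=> ET.
have le1 x : T - Q x * Q x `^ q <= P x * P x `^ q <= T.
  have := msol_UVp_le x.
  have : 0 < U x * U x `^ q * (V x * V x `^ q) by rewrite !mulr_gt0.
  by rewrite -(ET x); lra.
have T0 : 0 < T.
  have /andP[_] := le1 0; apply: lt_le_trans.
  by rewrite mulr_gt0 ?powR_gt0.
split=> //.
have -> : P = fun x => (P x * P x `^ q) `^ (q + 1)^-1.
  apply/funext => x; rewrite -pow1p// pow_inv ?ltW//.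
  by rewrite gt_eqF// addr_gt0.
have H : (fun x => P x * P x `^ q) x @[x --> +oo] --> T.
  apply/cvgrPdist_lt => e e0.
  have s : small (fun x => Q x * Q x `^ q).
    have -> : (fun x => Q x * Q x `^ q) = (fun x => Q x `^ (q + 1)).
      by apply/funext => x; rewrite pow1p.
    apply/(small_pow (addr_gt0 q0 ltr01) (fun x => ltW (Q0 x))).
    exact: msol_Q_small S.
  have [A HA] := s e e0.
  near=> x.
  have Ax : A <= x by near: x; apply: nbhs_pinfty_ge; exact: num_real.
  have := HA x Ax; have /andP[l1 l2] := le1 x.
  by rewrite ger0_norm ?subr_ge0//; lra.
exact: continuous_cvg _ (Dcont (is_derive1_powR (q + 1)^-1 T0)) H.
Unshelve. all: by end_near.
Qed.

End Decay.

(** * The linearized system *)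

Section Liouville.
Context {R : realType}.
Implicit Types (q x : R) (U V P Q k a b A B : R -> R).

(* The linearized system for a = phi / P and b = - psi / Q; A = P^p a' and
   B = Q^p b' are Wronskians of (phi, psi) with (U', V'). *)
Record lsol q P Q k a b A B : Prop := Lsol {
  lsol_k : forall x, 0 < k x;
  lsol_da : forall x, D a x (A x / (P x * P x `^ q));
  lsol_db : forall x, D b x (B x / (Q x * Q x `^ q));
  lsol_dA : forall x, D A x (k x * (a x - b x));
  lsol_dB : forall x, D B x (k x * (b x - a x));
  lsol_bnd : exists M, forall x, `|a x| * P x <= M /\ `|b x| * Q x <= M }.

Lemma lsol_opp q P Q k a b A B : lsol q P Q k a b A B ->
  lsol q P Q k (fun x => - a x) (fun x => - b x) (fun x => - A x) (fun x => - B x).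
Proof.
case=> k0 da db dA dB [M HM]; split => //.
- by move=> x; apply: Deq (Dopp (da x)) _; rewrite mulNr.
- by move=> x; apply: Deq (Dopp (db x)) _; rewrite mulNr.
- by move=> x; apply: Deq (Dopp (dA x)) _; ring.
- by move=> x; apply: Deq (Dopp (dB x)) _; ring.
- by exists M => x; rewrite !normrN.
Qed.

Lemma lsol_flip q P Q k a b A B : lsol q P Q k a b A B ->
  lsol q (fun x => Q (- x)) (fun x => P (- x)) (fun x => k (- x))
    (fun x => b (- x)) (fun x => a (- x)) (fun x => - B (- x)) (fun x => - A (- x)).
Proof.
case=> k0 da db dA dB [M HM]; split => //.
- by move=> x; apply: Deq (Dflip (db (- x))) _; rewrite mulNr.
- by move=> x; apply: Deq (Dflip (da (- x))) _; rewrite mulNr.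
- by move=> x; apply: Deq (Dopp (Dflip (dB (- x)))) _; ring.
- by move=> x; apply: Deq (Dopp (Dflip (dA (- x)))) _; ring.
- by exists M => x; have [] := HM (- x).
Qed.

(** The bound on a P bounds a to the right of 0 because P is nondecreasing. *)
Lemma lsol_a_bound q U V P Q k a b A B :
  msol q U V P Q -> lsol q P Q k a b A B ->
  exists2 M, 0 <= M & forall x, 0 <= x -> `|a x| <= M.
Proof.
move=> S [_ _ _ _ _ [M HM]]; exists (M / P 0) => [|x x0].
  have [h _] := HM 0; rewrite divr_ge0 ?(ltW (msol_P S 0))//.
  by apply: le_trans h; rewrite mulr_ge0// ltW// (msol_P S).
rewrite ler_pdivlMr ?(msol_P S)//; have [h _] := HM x; apply: le_trans h.
by rewrite ler_wpM2l// (msol_P_le S).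
Qed.

(* If b exceeds a at a point where it increases, then B >= beta > 0 from there
   on, so that b' >= beta / Q^p, which dominates any multiple of (1/Q)' since
   U^p V^(p-1) tends to 0; this contradicts the boundedness of b Q. *)
Lemma lsol_b_ubound q U V P Q k a b A B :
  msol q U V P Q -> lsol q P Q k a b A B ->
  exists N, forall x, 0 <= x -> b x <= N.
Proof.
move=> S L; have [Ma Ma0 Ha] := lsol_a_bound S L.
case: L => k0 da db dA dB [M HM].
have Qp x : 0 < Q x * Q x `^ q by rewrite mulr_gt0 ?powR_gt0 ?(msol_Q S).
have Qn x : Q x != 0 by rewrite gt_eqF ?(msol_Q S).
(* A value of b above b 0 provides a point where b increases; being above Ma, b also exceeds a
   there, so B increases too. *)
exists (Num.max Ma (b 0)) => x2 x20; rewrite leNgt; apply/negP => lt2.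
have [x1 [/andP[x10 _] b1 B1]] : exists x, [/\ 0 <= x <= x2,
    Num.max Ma (b 0) < b x & 0 < B x / (Q x * Q x `^ q)].
  by apply: (rise_point db x20 _ lt2); rewrite le_max lexx orbT.
have {}B1 : 0 < B x1 by rewrite pmulr_lgt0 ?invr_gt0 in B1.
have {}b1 : Ma < b x1 by move: b1; rewrite gt_max => /andP[].
have BB t : x1 <= t -> (forall s, x1 <= s < t -> 0 < b s - Ma) -> B x1 <= B t.
  move=> x1t Hs; apply: (Dle dB x1t) => s /andP[x1s st].
  rewrite mulr_ge0 ?(ltW (k0 s))//.
  have := Hs s; rewrite (ltW x1s) st => /(_ isT).
  have := Ha s; rewrite ler_norml => /(_ (le_trans x10 (ltW x1s))).
  by move=> /andP[_]; lra.
(* The two properties sustain each other: as long as b > Ma, B stays above B x1 > 0, so b stays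
   above b x1 > Ma. *)
have bM : forall t, x1 <= t -> 0 < b t - Ma.
  have cb := Dcontinuous (fun x => Dsub (db x) (Dc Ma x)).
  apply: (continuation cb); first by rewrite subr_gt0.
  move=> t x1t Hs; apply: (@lt_le_trans _ _ (b x1 - Ma)); first by rewrite subr_gt0.
  rewrite lerD2r; apply: (Dle db (ltW x1t)) => s /andP[x1s st].
  apply: divr_ge0; last exact: ltW.
  apply: le_trans (ltW B1) (BB s (ltW x1s) _) => r /andP[x1r rs].
  by apply: Hs; rewrite x1r (lt_trans rs st).
have {}BB t : x1 <= t -> B x1 <= B t.
  by move=> x1t; apply: BB => // s /andP[x1s _]; exact: bM.
have M0 : 0 <= M.
  by have [h _] := HM 0; apply: le_trans h; rewrite mulr_ge0// ltW// (msol_P S).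
have N0 : 0 < M + 1 by lra.
(* Beyond X one has (M + 1) U^p V^q < B x1 <= B, which makes b - (M + 1) / Q nondecreasing. *)
have [X HX] := msol_UpVq_small S (divr_gt0 B1 N0).
pose Y := Num.max x1 X; pose g x := b x - (M + 1) / Q x.
have gle x : Y <= x -> g Y <= g x.
  move=> Yx; apply: (Dle (f := g) (fun x => Dsub (db x)
    (Dscale (M + 1) (Dinv (Qn x) (msol_dQ S x)))) Yx).
  move=> y /andP[/ltW Yy _].
  have [x1y Xy] : x1 <= y /\ X <= y by move: Yy; rewrite ge_max => /andP[].
  have -> : B y / (Q y * Q y `^ q) - (M + 1) *
      (- - (U y * U y `^ q * V y `^ q * Q y / Q y `^ q) / Q y ^+ 2)
    = (B y - (M + 1) * (U y * U y `^ q * V y `^ q)) / (Q y * Q y `^ q).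
    by field; rewrite !gt_eqF ?powR_gt0 ?(msol_Q S).
  apply: divr_ge0; last exact: ltW.
  rewrite subr_ge0; apply: le_trans (BB y x1y).
  by rewrite mulrC -ler_pdivlMr// ltW// HX.
pose K := `|g Y| + 1.
have K0 : 0 < K by rewrite /K ltr_pwDr.
(* Multiplying g >= -K by Q gives b Q >= M + 1 - K Q; since b Q <= M, this forces Q >= 1/K, against
   the decay of Q. *)
have : K^-1 <= 0.
  apply: (small_nonneg (A := Y) (msol_Q_small S)) => x Yx.
  rewrite -div1r ler_pdivrMr//.
  have := gle x Yx; rewrite {2}/g => h1.
  have h2 : - K <= g Y by have := ler_norm (- g Y); rewrite normrN /K; lra.
  have {h1 h2}h3 : - K * Q x <= (b x - (M + 1) / Q x) * Q x.
    by rewrite ler_pM2r ?(msol_Q S)//; apply: le_trans h2 h1.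
  have h4 : (b x - (M + 1) / Q x) * Q x = b x * Q x - (M + 1).
    by field; rewrite gt_eqF ?(msol_Q S).
  have [_ h5] := HM x.
  have h6 : b x * Q x <= `|b x| * Q x by rewrite ler_pM2r ?ler_norm ?(msol_Q S).
  by lra.
by rewrite leNgt invr_gt0 K0.
Qed.

(** The functional is P^p a a' + Q^p b b'; the coupling terms combine into a square, so it is
    nondecreasing. *)
Lemma lsol_dF q U V P Q k a b A B x :
  msol q U V P Q -> lsol q P Q k a b A B ->
  D (fun x => A x * a x + B x * b x) x
    (k x * (a x - b x) ^+ 2 + A x ^+ 2 / (P x * P x `^ q)
      + B x ^+ 2 / (Q x * Q x `^ q)).
Proof.
move=> S [k0 da db dA dB _].
apply: Deq (Dadd (Dmul (dA x) (da x)) (Dmul (dB x) (db x))) _.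
by field; rewrite !gt_eqF ?powR_gt0 ?(msol_Q S) ?(msol_P S).
Qed.

(** With F the functional of [lsol_dF], P^p (a^2)' + Q^p (b^2)' = 2 F. If F were positive at x1 it
    would stay at least F x1; dividing by P^p, which is bounded, then yields a quantity with
    derivative bounded below by a positive constant, although a and b are bounded to the right of
    0. *)
Lemma lsol_F_le0 q U V P Q k a b A B :
  msol q U V P Q -> lsol q P Q k a b A B ->
  forall x, A x * a x + B x * b x <= 0.
Proof.
move=> S L x1; rewrite leNgt; apply/negP => F1.
have Pp x : 0 < P x * P x `^ q by rewrite mulr_gt0 ?powR_gt0 ?(msol_P S).
have Qp x : 0 < Q x * Q x `^ q by rewrite mulr_gt0 ?powR_gt0 ?(msol_Q S).
have [Ma Ma0 Ha] := lsol_a_bound S L.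
have [N1 HN1] := lsol_b_ubound S L.
have [N2 HN2] := lsol_b_ubound S (lsol_opp L).
pose N := Num.max N1 N2.
have HN x : 0 <= x -> b x ^+ 2 <= N ^+ 2.
  move=> x0; have h1 : b x <= N by rewrite le_max HN1.
  have h2 : - b x <= N by rewrite le_max HN2 ?orbT.
  by rewrite -subr_ge0 subr_sqr mulr_ge0//; lra.
have k0 := lsol_k L.
pose F x := A x * a x + B x * b x.
have Fle x y : x <= y -> F x <= F y.
  move=> xy; apply: (Dle (fun x => lsol_dF x S L) xy) => z _.
  by rewrite !addr_ge0// ?divr_ge0 ?sqr_ge0 ?(ltW (Pp z)) ?(ltW (Qp z))//
    mulr_ge0 ?sqr_ge0 ?(ltW (k0 z)).
have [M M0 PM] := msol_P_bound S.
have PMp x : P x * P x `^ q <= M * M `^ q.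
  exact: pow1_le (msol_q S) (msol_P S x) (PM x).
pose r x := Q x * Q x `^ q / (P x * P x `^ q).
pose dr x := - (q + 1) * (Q x * (U x * U x `^ q * V x `^ q) * (P x * P x `^ q)
  + Q x * Q x `^ q * (P x * (V x * V x `^ q * U x `^ q))) / (P x * P x `^ q) ^+ 2.
have Dr x : D r x (dr x).
  apply: Deq (Ddiv _ (Dmul (msol_dQ S x) (msol_dQq S x))
    (Dmul (msol_dP S x) (msol_dPq S x))) _; first by rewrite gt_eqF.
  by rewrite /dr; field; rewrite !gt_eqF ?powR_gt0 ?(msol_Q S) ?(msol_P S).
have dr0 x : dr x <= 0.
  have := msol_q S; have := msol_U S x; have := msol_V S x.
  have := msol_P S x; have := msol_Q S x => Q0 P0 V0 U0 q0.
  rewrite /dr mulNr mulNr oppr_le0.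
  rewrite divr_ge0 ?sqr_ge0// mulr_ge0 ?addr_ge0 ?ler01 ?(ltW q0)//.
    by rewrite !mulr_ge0 ?powR_ge0 ?(ltW P0) ?(ltW Q0) ?(ltW U0).
  by rewrite !mulr_ge0 ?powR_ge0 ?(ltW P0) ?(ltW Q0) ?(ltW V0).
(* The weight r = Q^p / P^p is nonincreasing. Subtracting N^2 >= b^2 makes the extra term (b^2 -
   N^2) r' of the derivative nonnegative and keeps G <= a^2. *)
pose G x := a x ^+ 2 + (b x ^+ 2 - N ^+ 2) * r x.
have DG x : D G x (2 * F x / (P x * P x `^ q) + (b x ^+ 2 - N ^+ 2) * dr x).
  apply: Deq (Dadd (Dsqr (lsol_da L x)) (Dmul (Dsub (Dsqr (lsol_db L x))
    (Dc (N ^+ 2) x)) (Dr x))) _.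
  by rewrite /r /F; field; rewrite !gt_eqF ?powR_gt0 ?(msol_Q S) ?(msol_P S).
have Ga x : 0 <= x -> G x <= Ma ^+ 2.
  move=> x0; have h1 := HN x x0.
  have h2 : a x ^+ 2 <= Ma ^+ 2.
    have := Ha x x0; rewrite ler_norml => /andP[h3 h4].
    by rewrite -subr_ge0 subr_sqr mulr_ge0//; lra.
  have h3 : 0 <= r x by rewrite divr_ge0// ltW.
  have : (b x ^+ 2 - N ^+ 2) * r x <= 0 by rewrite mulr_le0_ge0// subr_le0.
  by rewrite /G; lra.
pose c := 2 * F x1 / (M * M `^ q).
have c0 : 0 < c by rewrite divr_gt0 ?mulr_gt0 ?powR_gt0.
pose x2 := Num.max x1 0.
have x20 : 0 <= x2 by rewrite le_max lexx orbT.
have x12 : x1 <= x2 by rewrite le_max lexx.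
(* Growth of G at rate c from x2 on reaches Ma^2 + 1 at y, above the bound Ma^2. *)
pose y := x2 + (Ma ^+ 2 - G x2 + 1) / c.
have h0 : 0 <= Ma ^+ 2 - G x2 by rewrite subr_ge0 Ga.
have x2y : x2 <= y by rewrite /y lerDl divr_ge0 ?(ltW c0)//; lra.
have : G x2 + c * (y - x2) <= G y.
  apply: (Dle_lin DG x2y) => z /andP[/ltW x2z _].
  have z0 : 0 <= z by apply: le_trans x2z.
  have h1 : 0 <= (b z ^+ 2 - N ^+ 2) * dr z.
    by rewrite mulr_le0// ?subr_le0 ?HN.
  have h2 : c <= 2 * F z / (P z * P z `^ q).
    apply: ler_pM.
    - by rewrite mulr_ge0 ?(ltW F1).
    - by rewrite invr_ge0 mulr_ge0 ?powR_ge0 ?(ltW M0).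
    - by rewrite ler_pM2l// Fle// (le_trans x12).
    - by rewrite lef_pV2 ?posrE ?mulr_gt0 ?powR_gt0 ?(msol_P S) ?PMp.
  by lra.
have -> : c * (y - x2) = Ma ^+ 2 - G x2 + 1 by rewrite /y; field; rewrite gt_eqF.
by have := Ga y (le_trans x20 x2y); lra.
Qed.

Lemma lsol_const q U V P Q k a b A B :
  msol q U V P Q -> lsol q P Q k a b A B ->
  exists c, forall x, a x = c /\ b x = c.
Proof.
move=> S L; pose F x := A x * a x + B x * b x.
have F0 x : F x = 0.
  apply/eqP; rewrite eq_le (lsol_F_le0 S L)/=.
  (* The functional of the reflected solution at -x is - F x, which gives the opposite inequality.
     With F = 0, each nonnegative term of its derivative vanishes. *)
  have := lsol_F_le0 (msol_flip S) (lsol_flip L) (- x).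
  by rewrite /= !opprK /F; lra.
have k0 := lsol_k L.
have Pp x : 0 < P x * P x `^ q by rewrite mulr_gt0 ?powR_gt0 ?(msol_P S).
have Qp x : 0 < Q x * Q x `^ q by rewrite mulr_gt0 ?powR_gt0 ?(msol_Q S).
have dF0 x : k x * (a x - b x) ^+ 2 + A x ^+ 2 / (P x * P x `^ q)
      + B x ^+ 2 / (Q x * Q x `^ q) = 0.
  have := Dder (lsol_dF x S L).
  have -> : (fun x => A x * a x + B x * b x) = (fun=> 0) by apply/funext.
  by move=> <-; exact: Dder (Dc 0 x).
have h1 x : 0 <= k x * (a x - b x) ^+ 2 by rewrite mulr_ge0 ?sqr_ge0 ?(ltW (k0 x)).
have h2 x : 0 <= A x ^+ 2 / (P x * P x `^ q) by rewrite divr_ge0 ?sqr_ge0 ?(ltW (Pp x)).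
have h3 x : 0 <= B x ^+ 2 / (Q x * Q x `^ q) by rewrite divr_ge0 ?sqr_ge0 ?(ltW (Qp x)).
have ab x : a x = b x.
  have : k x * (a x - b x) ^+ 2 = 0.
    by have := h1 x; have := h2 x; have := h3 x; have := dF0 x; lra.
  move/eqP; rewrite mulf_eq0 gt_eqF//= sqrf_eq0 subr_eq0 => /eqP; exact.
have A0 x : A x = 0.
  have : A x ^+ 2 / (P x * P x `^ q) = 0.
    by have := h1 x; have := h2 x; have := h3 x; have := dF0 x; lra.
  by move/eqP; rewrite mulf_eq0 sqrf_eq0 invr_eq0 (gt_eqF (Pp x)) orbF => /eqP.
exists (a 0) => x; rewrite -ab; split=> //;
  by apply: (Dconst (lsol_da L)) => y; rewrite A0 mul0r.
Qed.

End Liouville.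

(** * Symmetry *)

Section Symmetry.
Context {R : realType}.
Implicit Types (q x y : R) (U V P Q : R -> R).

Lemma Dln (f : R -> R) x l : 0 < f x -> D f x l -> D (fun t => ln (f t)) x (l / f x).
Proof. by move=> f0 F; apply: Deq (Dcomp F (is_derive1_ln f0)) _; rewrite mulrC. Qed.

Lemma gronwall (E e : R -> R) (K X : R) : (forall x, D E x (e x)) ->
  (forall x, 0 < x < X -> e x <= K * E x) -> E 0 = 0 ->
  forall x, 0 <= x <= X -> E x <= 0.
Proof.
move=> dE eK E0 x /andP[x0 xX].
have := Dge (fun x => Dmul (dE x) (Dexp (Dscale (- K) (Did x)))) x0.
rewrite /= E0 mul0r => H.
have {}H : E x * expR (- K * x) <= 0.
  apply: H => y /andP[y0 yx].
  have -> : E y * (expR (- K * y) * (- K * 1)) + expR (- K * y) * e y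
    = expR (- K * y) * (e y - K * E y) by ring.
  by rewrite mulr_ge0_le0 ?expR_ge0// subr_le0 eK// y0 (lt_le_trans yx).
by rewrite pmulr_lle0 ?expR_gt0 in H.
Qed.

(** The exponential is H-Lipschitz where its values are at most H. This converts differences of the
    growth rates into differences of their logarithms. *)
Lemma dist_le_ln (H a b : R) : 0 < a <= H -> 0 < b <= H ->
  `|a - b| <= H * `|ln a - ln b|.
Proof.
wlog ab : a b / a <= b => [W ha hb|].
  case/orP: (le_total a b) => h; first exact: W.
  by rewrite (distrC a) (distrC (ln a)); exact: W.
move=> /andP[a0 aH] /andP[b0 bH].
have lab : ln a <= ln b by rewrite ler_ln ?posrE.
rewrite distrC (distrC (ln a)) !ger0_norm ?subr_ge0//.
have h : ln (a / b) <= a / b - 1.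
  have := @le_ln1Dx R (a / b - 1); rewrite [1 + _]addrC subrK; apply.
  by rewrite ltrBrDl subrr divr_gt0.
have h2 : b - a <= b * (ln b - ln a).
  rewrite ln_div ?posrE// in h.
  have := ler_wpM2l (ltW b0) h; rewrite mulrBr.
  have -> : b * (a / b - 1) = a - b by field; rewrite gt_eqF.
  by lra.
by apply: le_trans h2 _; rewrite ler_wpM2r// subr_ge0.
Qed.

(* The sum of |U'| / U, |V'| / V, |P'| / P and |Q'| / Q. *)
Definition rates q U V P Q x :=
  P x / U x + Q x / V x + V x * V x `^ q * U x `^ q / P x `^ q
  + U x * U x `^ q * V x `^ q / Q x `^ q.

Lemma msol_rates_bound q U V P Q X : msol q U V P Q ->
  exists H, forall x, 0 <= x <= X -> rates q U V P Q x <= H.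
Proof.
move=> S.
have U0 := msol_U S; have V0 := msol_V S; have P0 := msol_P S; have Q0 := msol_Q S.
have ne (f : R -> R) x : (forall x, 0 < f x) -> f x != 0.
  by move=> f0; rewrite gt_eqF.
have nP x : P x `^ q != 0 by rewrite gt_eqF ?powR_gt0.
have nQ x : Q x `^ q != 0 by rewrite gt_eqF ?powR_gt0.
have [X0|X0] := lerP 0 X; last first.
  by exists 0 => x /andP[x0 xX]; move: (le_lt_trans (le_trans x0 xX) X0); rewrite ltxx.
have dU := msol_dU S; have dV := msol_dV S.
have dP := msol_dP S; have dQ := msol_dQ S.
have dUq := msol_dUq S; have dVq := msol_dVq S.
have dPq := msol_dPq S; have dQq := msol_dQq S.
have c : continuous (rates q U V P Q).
  move=> x; rewrite /rates; have h := (Dadd (Dadd (Dadd (Ddiv (ne _ x U0) (dP x) (dU x))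
    (Ddiv (ne _ x V0) (dQ x) (dV x)))
    (Ddiv (g := fun t => P t `^ q) (nP x) (Dmul (Dmul (dV x) (dVq x)) (dUq x)) (dPq x)))
    (Ddiv (g := fun t => Q t `^ q) (nQ x) (Dmul (Dmul (dU x) (dUq x)) (dVq x)) (dQq x))).
  exact: Dcont h.
have [y _ Hy] := EVT_max X0 (continuous_subspaceT c).
by exists (rates q U V P Q y) => x x0; apply: Hy; rewrite in_itv.
Qed.

(* The right-hand sides are not Lipschitz near 0, but in logarithmic variables
   they are exponentials of linear forms, bounded on compact intervals. *)
Lemma msol_unique q U V P Q U1 V1 P1 Q1 :
  msol q U V P Q -> msol q U1 V1 P1 Q1 ->
  U 0 = U1 0 -> V 0 = V1 0 -> P 0 = P1 0 -> Q 0 = Q1 0 ->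
  forall x, 0 <= x -> U x = U1 x /\ V x = V1 x.
Proof.
move=> S T eU eV eP eQ X X0.
have q0 := msol_q S.
have U0 := msol_U S; have V0 := msol_V S; have P0 := msol_P S; have Q0 := msol_Q S.
have U10 := msol_U T; have V10 := msol_V T; have P10 := msol_P T; have Q10 := msol_Q T.
have dl (f g : R -> R) (df dg : R -> R) : (forall x, 0 < f x) -> (forall x, 0 < g x) ->
    (forall x, D f x (df x)) -> (forall x, D g x (dg x)) ->
    forall x, D (fun x => ln (f x) - ln (g x)) x (df x / f x - dg x / g x).
  by move=> f0 g0 Df Dg x; exact: Dsub (Dln (f0 x) (Df x)) (Dln (g0 x) (Dg x)).
pose d1 x := ln (U x) - ln (U1 x); pose d2 x := ln (V x) - ln (V1 x).
pose d3 x := ln (P x) - ln (P1 x); pose d4 x := ln (Q x) - ln (Q1 x).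
have D1 := dl _ _ _ _ U0 U10 (msol_dU S) (msol_dU T).
have D2 := dl _ _ _ _ V0 V10 (msol_dV S) (msol_dV T).
have D3 := dl _ _ _ _ P0 P10 (msol_dP S) (msol_dP T).
have D4 := dl _ _ _ _ Q0 Q10 (msol_dQ S) (msol_dQ T).
pose E x := d1 x ^+ 2 + d2 x ^+ 2 + d3 x ^+ 2 + d4 x ^+ 2.
have dE x := Dadd (Dadd (Dadd (Dsqr (D1 x)) (Dsqr (D2 x))) (Dsqr (D3 x))) (Dsqr (D4 x)).
have [H1 HH1] := msol_rates_bound X S.
have [H2 HH2] := msol_rates_bound X T.
pose H := Num.max H1 H2; pose L := H * (q + 1).
(* The four summands of [rates] are positive, so a bound on the sum bounds each of them. *)
have bd q' U' V' P' Q' x : msol q' U' V' P' Q' -> rates q' U' V' P' Q' x <= H ->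
  [/\ 0 < P' x / U' x <= H, 0 < Q' x / V' x <= H,
      0 < V' x * V' x `^ q' * U' x `^ q' / P' x `^ q' <= H &
      0 < U' x * U' x `^ q' * V' x `^ q' / Q' x `^ q' <= H].
  move=> S'; rewrite /rates.
  have u := msol_U S' x; have v := msol_V S' x.
  have p := msol_P S' x; have w := msol_Q S' x.
  have r1 : 0 < P' x / U' x by rewrite divr_gt0.
  have r2 : 0 < Q' x / V' x by rewrite divr_gt0.
  have r3 : 0 < V' x * V' x `^ q' * U' x `^ q' / P' x `^ q'.
    by rewrite !(mulr_gt0, invr_gt0) ?powR_gt0.
  have r4 : 0 < U' x * U' x `^ q' * V' x `^ q' / Q' x `^ q'.
    by rewrite !(mulr_gt0, invr_gt0) ?powR_gt0.
  by rewrite r1 r2 r3 r4 => h; split; lra.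
(* With t the sum of the |d_i|, the logarithm of each rate changes by a linear form in the d_i of
   size at most (q + 1) t, so each rate changes by at most L t. Hence the derivative of E is at most
   2 L t^2, and t^2 <= 4 E by Cauchy-Schwarz. *)
have EL x : 0 < x < X ->
  2 * d1 x * (P x / U x - P1 x / U1 x) +
  2 * d2 x * (- Q x / V x - - Q1 x / V1 x) +
  2 * d3 x * (V x * V x `^ q * U x `^ q * P x / P x `^ q / P x -
    V1 x * V1 x `^ q * U1 x `^ q * P1 x / P1 x `^ q / P1 x) +
  2 * d4 x * (- (U x * U x `^ q * V x `^ q * Q x / Q x `^ q) / Q x -
    - (U1 x * U1 x `^ q * V1 x `^ q * Q1 x / Q1 x `^ q) / Q1 x) <= 8 * L * E x.
  move=> /andP[/ltW x0 /ltW xX].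
  have hx : 0 <= x <= X by rewrite x0.
  have [b1 b2 b3 b4] : [/\ 0 < P x / U x <= H, 0 < Q x / V x <= H,
      0 < V x * V x `^ q * U x `^ q / P x `^ q <= H &
      0 < U x * U x `^ q * V x `^ q / Q x `^ q <= H].
    by apply: bd S _; rewrite le_max HH1.
  have [c1 c2 c3 c4] : [/\ 0 < P1 x / U1 x <= H, 0 < Q1 x / V1 x <= H,
      0 < V1 x * V1 x `^ q * U1 x `^ q / P1 x `^ q <= H &
      0 < U1 x * U1 x `^ q * V1 x `^ q / Q1 x `^ q <= H].
    by apply: bd T _; rewrite le_max HH2 ?orbT.
  have s1 := dist_le_ln b1 c1; have s2 := dist_le_ln b2 c2.
  have s3 := dist_le_ln b3 c3; have s4 := dist_le_ln b4 c4.
  have H0 : 0 <= H by have /andP[h1 h2] := b1; rewrite ltW// (lt_le_trans h1).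
  have lnP a b : 0 < a -> 0 < b -> ln (a / b) = ln a - ln b.
    by move=> ? ?; rewrite ln_div ?posrE.
  have lnM a b : 0 < a -> 0 < b -> ln (a * b) = ln a + ln b :> R.
    by move=> ? ?; rewrite lnM ?posrE.
  rewrite !(lnP, lnM, ln_powR, mulr_gt0, powR_gt0)// in s1 s2 s3 s4.
  have cancel (a b c : R) : 0 < b -> a * b / c / b = a / c.
    by move=> b0; rewrite (mulrAC a b) mulfK ?gt_eqF.
  pose t := `|d1 x| + `|d2 x| + `|d3 x| + `|d4 x|.
  have n1 := normr_ge0 (d1 x); have n2 := normr_ge0 (d2 x).
  have n3 := normr_ge0 (d3 x); have n4 := normr_ge0 (d4 x).
  have key (c s d v : R) : `|s| <= H * `|v| -> `|v| <= (q + 1) * t -> `|d| = c ->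
      d * s <= c * (L * t).
    move=> h1 h2 <-; apply: le_trans (ler_norm _) _; rewrite normrM.
    rewrite ler_wpM2l//; apply: le_trans h1 _; rewrite /L -mulrA.
    exact: ler_wpM2l.
  have qt0 : 0 <= q * t by rewrite mulr_ge0 ?(ltW q0)// /t; lra.
  have v1 : `|ln (P x) - ln (U x) - (ln (P1 x) - ln (U1 x))| <= (q + 1) * t.
    have -> : ln (P x) - ln (U x) - (ln (P1 x) - ln (U1 x)) = d3 x - d1 x.
      by rewrite /d3 /d1; ring.
    by apply: le_trans (ler_normB _ _) _; rewrite mulrDl mul1r /t in qt0 *; lra.
  have v2 : `|ln (Q x) - ln (V x) - (ln (Q1 x) - ln (V1 x))| <= (q + 1) * t.
    have -> : ln (Q x) - ln (V x) - (ln (Q1 x) - ln (V1 x)) = d4 x - d2 x.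
      by rewrite /d4 /d2; ring.
    by apply: le_trans (ler_normB _ _) _; rewrite mulrDl mul1r /t in qt0 *; lra.
  have lin a b c : `|(q + 1) * a + q * b - q * c| <= q * `|a| + `|a| + q * `|b| + q * `|c|.
    apply: le_trans (ler_normB _ _) _; rewrite (normrM q c).
    rewrite (gtr0_norm q0) lerD2r.
    apply: le_trans (ler_normD _ _) _; rewrite !normrM.
    by rewrite (gtr0_norm q0) gtr0_norm ?addr_gt0// mulrDl mul1r.
  have v3 : `|ln (V x) + q * ln (V x) + q * ln (U x) - q * ln (P x) -
      (ln (V1 x) + q * ln (V1 x) + q * ln (U1 x) - q * ln (P1 x))| <= (q + 1) * t.
    have -> : ln (V x) + q * ln (V x) + q * ln (U x) - q * ln (P x) -
      (ln (V1 x) + q * ln (V1 x) + q * ln (U1 x) - q * ln (P1 x)) =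
      (q + 1) * d2 x + q * d1 x - q * d3 x by rewrite /d1 /d2 /d3; ring.
    apply: le_trans (lin _ _ _) _; rewrite mulrDl mul1r /t !mulrDr.
    by have := mulr_ge0 (ltW q0) n4; lra.
  have v4 : `|ln (U x) + q * ln (U x) + q * ln (V x) - q * ln (Q x) -
      (ln (U1 x) + q * ln (U1 x) + q * ln (V1 x) - q * ln (Q1 x))| <= (q + 1) * t.
    have -> : ln (U x) + q * ln (U x) + q * ln (V x) - q * ln (Q x) -
      (ln (U1 x) + q * ln (U1 x) + q * ln (V1 x) - q * ln (Q1 x)) =
      (q + 1) * d1 x + q * d2 x - q * d4 x by rewrite /d1 /d2 /d4; ring.
    apply: le_trans (lin _ _ _) _; rewrite mulrDl mul1r /t !mulrDr.
    by have := mulr_ge0 (ltW q0) n3; lra.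
  have k1 := key _ _ (d1 x) _ s1 v1 erefl.
  have k2 := key _ _ (- d2 x) _ s2 v2 (normrN _).
  have k3 := key _ _ (d3 x) _ s3 v3 erefl.
  have k4 := key _ _ (- d4 x) _ s4 v4 (normrN _).
  rewrite !mulNr !cancel//.
  have L0 : 0 <= L by rewrite mulr_ge0// addr_ge0// ltW.
  have : t * t <= 4 * E x.
    rewrite /E -(real_normK (num_real (d1 x))) -(real_normK (num_real (d2 x))).
    rewrite -(real_normK (num_real (d3 x))) -(real_normK (num_real (d4 x))).
    rewrite /t; move: `|d1 x| `|d2 x| `|d3 x| `|d4 x| => a b c d.
    have := sqr_ge0 (a - b); have := sqr_ge0 (a - c); have := sqr_ge0 (a - d).
    have := sqr_ge0 (b - c); have := sqr_ge0 (b - d); have := sqr_ge0 (c - d).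
    by lra.
  move=> /(ler_wpM2l L0) ht.
  have : `|d1 x| * (L * t) + `|d2 x| * (L * t) + `|d3 x| * (L * t) + `|d4 x| * (L * t)
    = L * (t * t) by rewrite -!mulrDl -/t mulrCA.
  lra.
have E0 : E 0 = 0 by rewrite /E /d1 /d2 /d3 /d4 eU eV eP eQ !subrr expr0n/= !addr0.
have EX : E X <= 0.
  by apply: (gronwall dE EL E0); rewrite X0 lexx.
have z1 := sqr_ge0 (d1 X); have z2 := sqr_ge0 (d2 X).
have z3 := sqr_ge0 (d3 X); have z4 := sqr_ge0 (d4 X).
split; apply: ln_inj; rewrite ?posrE//; apply/eqP; rewrite -subr_eq0 -sqrf_eq0.
  by apply/eqP; rewrite -/(d1 X); move: EX; rewrite /E; lra.
by apply/eqP; rewrite -/(d2 X); move: EX; rewrite /E; lra.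
Qed.

(* Otherwise V - V1 would increase from 0 although V tends to 0. *)
Lemma msol_compare q U V P Q U1 V1 P1 Q1 :
  msol q U V P Q -> msol q U1 V1 P1 Q1 ->
  U 0 = U1 0 -> V 0 = V1 0 -> P1 0 < P 0 -> Q 0 < Q1 0 -> False.
Proof.
move=> S T eU eV lP lQ.
have q0 := msol_q S.
have U0 := msol_U S; have V0 := msol_V S; have P0 := msol_P S; have Q0 := msol_Q S.
have U10 := msol_U T; have V10 := msol_V T; have P10 := msol_P T; have Q10 := msol_Q T.
have dUU x := Dsub (msol_dU S x) (msol_dU T x).
have dVV x := Dsub (msol_dV S x) (msol_dV T x).
pose f x := Num.min (P x - P1 x) (Q1 x - Q x).
have cf : continuous f.
  move=> x; apply: (@continuous_min _ _ (fun x => P x - P1 x) (fun x => Q1 x - Q x)).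
    exact: Dcont (Dsub (msol_dP S x) (msol_dP T x)).
  exact: Dcont (Dsub (msol_dQ T x) (msol_dQ S x)).
have fP x : 0 < f x -> P1 x < P x /\ Q x < Q1 x.
  by rewrite lt_min !subr_gt0 => /andP.
have f0 : 0 < f 0 by rewrite lt_min !subr_gt0 lP lQ.
have fpos : forall t, 0 <= t -> 0 < f t.
  (* While f > 0, U - U1 and V - V1 are nondecreasing from 0; then P^q - P1^q and Q1^q - Q^q are
     nondecreasing as well, so both strict inequalities persist. *)
  apply: (continuation cf f0) => t t0 Hs.
  have UU s : 0 <= s <= t -> U1 s <= U s.
    move=> /andP[s0 st]; rewrite -subr_ge0 -[leLHS](subrr (U 0)) {2}eU.
    apply: (Dle dUU s0) => r /andP[r0 rs]; rewrite subr_ge0.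
    have [|h _] := fP r; last exact: ltW.
    by apply: Hs; rewrite (ltW r0) (lt_le_trans rs st).
  have VV s : 0 <= s <= t -> V1 s <= V s.
    move=> /andP[s0 st]; rewrite -subr_ge0 -[leLHS](subrr (V 0)) {2}eV.
    apply: (Dle dVV s0) => r /andP[r0 rs]; rewrite opprK addrC subr_ge0.
    have [|_ h] := fP r; last exact: ltW.
    by apply: Hs; rewrite (ltW r0) (lt_le_trans rs st).
  rewrite lt_min !subr_gt0; apply/andP; split.
    apply: (pow_lt_inv q0); first exact: ltW.
    rewrite -subr_gt0; apply: (@lt_le_trans _ _ (P 0 `^ q - P1 0 `^ q)).
      by rewrite subr_gt0; apply: pow_lt => //; exact: ltW.
    apply: (Dle (fun x => Dsub (msol_dPq S x) (msol_dPq T x)) (ltW t0)).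
    move=> s /andP[s0 st].
    rewrite -mulrBr mulr_ge0 ?(ltW q0)// subr_ge0.
    have st' : 0 <= s <= t by rewrite !ltW.
    apply: ler_pM; rewrite ?mulr_ge0 ?powR_ge0 ?(ltW (V10 s))//.
      by apply: pow1_le => //; exact: VV.
    by apply: pow_le => //; [exact: ltW|exact: UU].
  apply: (pow_lt_inv q0); first exact: ltW.
  rewrite -subr_gt0; apply: (@lt_le_trans _ _ (Q1 0 `^ q - Q 0 `^ q)).
    by rewrite subr_gt0; apply: pow_lt => //; exact: ltW.
  apply: (Dle (fun x => Dsub (msol_dQq T x) (msol_dQq S x)) (ltW t0)).
  move=> s /andP[s0 st].
  rewrite -opprD oppr_ge0 -mulrBr mulr_ge0_le0 ?(ltW q0)// subr_le0.
  have st' : 0 <= s <= t by rewrite !ltW.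
  apply: ler_pM; rewrite ?mulr_ge0 ?powR_ge0 ?(ltW (U10 s))//.
    by apply: pow1_le => //; exact: UU.
  by apply: pow_le => //; [exact: ltW|exact: VV].
have dpos x : 0 <= x -> 0 < - Q x - - Q1 x.
  by move=> /fpos /fP[_ h]; rewrite opprK addrC subr_gt0.
have V1pos : 0 < V 1 - V1 1.
  rewrite -[ltLHS](subrr (V 0)) {2}eV; apply: (Dlt dVV ltr01) => s /andP[s0 _].
  exact: dpos (ltW s0).
suff : V 1 - V1 1 <= 0 by rewrite leNgt V1pos.
apply: (small_nonneg (A := 1) (msol_V_small S)) => x x1.
apply: (@le_trans _ _ (V x - V1 x)); last by rewrite gerBl ltW.
apply: (Dle dVV x1) => s /andP[s1 _]; apply: ltW (dpos s _).
by rewrite (le_trans ler01 (ltW s1)).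
Qed.

Lemma msol_even q U V P Q : msol q U V P Q -> U 0 = V 0 ->
  forall y, V y = U (- y).
Proof.
move=> S e; have T := msol_flip S.
have eU : U 0 = V (- 0) by rewrite oppr0.
have eV : V 0 = U (- 0) by rewrite oppr0.
have eP : P 0 = Q (- 0).
  (* For a solution and its reflection the two strict hypotheses of [msol_compare] are the same
     inequality between P 0 and Q 0; the two orders correspond to exchanging the solutions. *)
  rewrite oppr0; apply/eqP; rewrite eq_le !leNgt; apply/andP; split; apply/negP => h.
    by apply: (msol_compare S T eU eV); rewrite /= oppr0.
  by apply: (msol_compare T S (esym eU) (esym eV)); rewrite /= oppr0.
have eQ : Q 0 = P (- 0) by rewrite oppr0 in eP *.
have H := msol_unique S T eU eV eP eQ.
move=> y; case: (lerP 0 y) => [y0|/ltW y0]; first by have [_ ->] := H y y0.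
by have [|-> _] := H (- y); rewrite ?opprK// oppr_ge0.
Qed.

(** V tends to 0 at +oo while U >= U 0 there, and the reverse holds at -oo; the intermediate value
    theorem gives the crossing, which is the center of symmetry. *)
Lemma msol_cross q U V P Q : msol q U V P Q -> exists x0, U x0 = V x0.
Proof.
move=> S.
have [A HA] := msol_V_small S (msol_U S 0).
have [B HB] := msol_V_small (msol_flip S) (msol_V S 0).
rewrite /= in HB.
pose b := Num.max A 0; pose a := Num.max B 0.
have b0 : 0 <= b by rewrite le_max lexx orbT.
have a0 : 0 <= a by rewrite le_max lexx orbT.
have hb : V b < U b.
  by apply: lt_le_trans (HA b _) (msol_U_le S b0); rewrite le_max lexx.
have ha : U (- a) < V (- a).
  apply: lt_le_trans (HB a _) (msol_V_le S _); first by rewrite le_max lexx.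
  by rewrite oppr_le0.
have ab : - a <= b by rewrite (@le_trans _ _ 0) ?oppr_le0.
have c : continuous (fun x => U x - V x).
  exact: Dcontinuous (fun x => Dsub (msol_dU S x) (msol_dV S x)).
have [|x _ /eqP] := IVT (v := 0) ab (continuous_subspaceT c).
  by rewrite ge_min le_max !subr_ge0 !subr_le0 (ltW ha) (ltW hb) orbT.
by rewrite subr_eq0 => /eqP; exists x.
Qed.

Lemma msol_reflected q U V P Q : msol q U V P Q -> reflected U V.
Proof.
move=> S; have [x0 e] := msol_cross S; exists x0 => y.
have := msol_even (msol_shift x0 S); rewrite !addr0 => /(_ e y) ->.
by [].
Qed.

End Symmetry.

(** * Signs of the derivatives *)

Section Reduction.
Context {R : realType}.
Implicit Types (p x y m : R) (U V : R -> R).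

Lemma flux_ge0E p w : 1 < p -> 0 <= w -> `|w| `^ (p - 2) * w = w `^ (p - 1) :> R.
Proof.
move=> p1; rewrite le_eqVlt => /orP[/eqP<-|w0].
  (* At w = 0 both sides vanish, the right one because p - 1 is not 0. *)
  by rewrite mulr0 powR0// gt_eqF// subr_gt0.
rewrite gtr0_norm//; have -> : p - 2 = (p - 1) - 1 by ring.
by rewrite pow1m// divfK// gt_eqF.
Qed.

Lemma flux_le0E p w : 1 < p -> w <= 0 ->
  `|w| `^ (p - 2) * w = - ((- w) `^ (p - 1)) :> R.
Proof.
move=> p1 w0; rewrite -(flux_ge0E p1) ?oppr_ge0// normrN.
by rewrite mulrN opprK.
Qed.

Lemma flux_ge0 p w : 1 < p -> (0 <= `|w| `^ (p - 2) * w) = (0 <= w :> R).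
Proof.
move=> p1; case: (lerP 0 w) => w0; first by rewrite flux_ge0E// powR_ge0.
apply/negbTE; rewrite -ltNge flux_le0E ?(ltW w0)// oppr_lt0 powR_gt0//.
by rewrite oppr_gt0.
Qed.

Lemma half_solution_dU p U V x : half_solution p U V -> D U x (derive1 U x).
Proof. by case=> -[h _] _ _; exact: derD. Qed.

Lemma half_solution_dF p U V x : 1 < p -> half_solution p U V ->
  D (flux p U U) x ((p - 1) * (V x `^ p * U x `^ (p - 1))).
Proof.
move=> p1 [_ h1 h2]; apply: Deq (derD (h1 x)) _.
by rewrite -h2 /plap mulrA mulfV ?mul1r// gt_eqF// subr_gt0.
Qed.

Lemma half_solution_flux_le p U V x y : 1 < p -> (forall x, 0 < U x) ->
  half_solution p U V -> x <= y -> flux p U U x <= flux p U U y.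
Proof.
move=> p1 U0 S xy; apply: (Dle (fun x => half_solution_dF x p1 S) xy) => z _.
by rewrite mulr_ge0 ?mulr_ge0 ?powR_ge0// subr_ge0 ltW.
Qed.

(** The flux is nondecreasing and has the sign of U'. *)
Lemma half_solution_dU_ge0 p U V x y : 1 < p -> (forall x, 0 < U x) ->
  half_solution p U V -> x <= y -> 0 <= derive1 U x -> 0 <= derive1 U y.
Proof.
move=> p1 U0 S xy h; rewrite -(flux_ge0 _ p1).
apply: le_trans (half_solution_flux_le p1 U0 S xy).
by rewrite /flux flux_ge0.
Qed.

(** While U, V >= m, the flux grows at rate at least (p - 1) m^(2p-1). After a time k / m it reaches
    (m^2 / k)^(p-1), by the normalization (p - 1) k^p = 1; then U' >= m^2 / k, and a second time k /
    m adds m to U. *)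
Lemma half_solution_double p U V x0 m k : 1 < p -> (forall x, 0 < U x) ->
  half_solution p U V -> 0 < k -> (p - 1) * (k * k `^ (p - 1)) = 1 -> 0 < m ->
  (forall x, x0 <= x -> m <= V x) -> m <= U x0 -> 0 <= derive1 U x0 ->
  2 * m <= U (x0 + 2 * k / m).
Proof.
move=> p1 U0 S k0 ek m0 mV mU dU0.
have q0 : 0 < p - 1 by rewrite subr_gt0.
have km0 : 0 < k / m by rewrite divr_gt0.
have dU x : x0 <= x -> 0 <= derive1 U x.
  by move=> x0x; exact: half_solution_dU_ge0 p1 U0 S x0x dU0.
have hU x : x0 <= x -> m <= U x.
  move=> x0x; apply: le_trans mU _.
  apply: (Dle (fun x => half_solution_dU x S) x0x) => y /andP[/ltW yx _].
  exact: dU.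
have hm x : x0 <= x -> (p - 1) * (m * m `^ (p - 1) * m `^ (p - 1)) <=
    (p - 1) * (V x `^ p * U x `^ (p - 1)).
  move=> x0x; rewrite ler_pM2l//.
  have -> : V x `^ p = V x * V x `^ (p - 1).
    by rewrite -pow1p ?subrK// (lt_le_trans m0) ?mV.
  apply: ler_pM; rewrite ?mulr_ge0 ?powR_ge0 ?(ltW m0)//.
    by apply: pow1_le => //; exact: mV.
  by apply: pow_le => //; [exact: ltW|exact: hU].
have hd x : x0 + k / m <= x -> m * m / k <= derive1 U x.
  move=> xx; have x0x : x0 <= x by apply: le_trans xx; rewrite lerDl ltW.
  rewrite ler_pdivrMr//; apply: (pow_le_inv q0).
  - by rewrite mulr_ge0 ?(ltW m0).
  - by rewrite mulr_ge0 ?dU ?(ltW k0).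
  have k1 : x0 <= x0 + k / m by rewrite lerDl ltW.
  have := Dle_lin (fun x => half_solution_dF x p1 S) k1.
  move=> /(_ _ (fun y hy => hm y (ltW (proj1 (andP hy))))).
  rewrite addrAC subrr add0r => h1.
  have h0 : 0 <= flux p U U x0 by rewrite /flux flux_ge0.
  have h2 := half_solution_flux_le p1 U0 S xx.
  rewrite {2}/flux flux_ge0E ?dU// in h2.
  rewrite !powRM ?dU ?(ltW m0) ?(ltW k0)//.
  have -> : m `^ (p - 1) * m `^ (p - 1) =
      (p - 1) * (m * m `^ (p - 1) * m `^ (p - 1)) * (k / m) * k `^ (p - 1).
    transitivity (m `^ (p - 1) * m `^ (p - 1) * ((p - 1) * (k * k `^ (p - 1)))).
      by rewrite ek mulr1.
    by field; rewrite gt_eqF.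
  by rewrite ler_pM2r ?powR_gt0//; lra.
have h1 : U x0 <= U (x0 + k / m).
  apply: (Dle (fun x => half_solution_dU x S)); first by rewrite lerDl ltW.
  by move=> y /andP[/ltW yx _]; exact: dU.
have x12 : x0 + k / m <= x0 + 2 * k / m.
  by rewrite -mulrA lerD2l ler_peMl ?ltW// ltr1n.
have := Dle_lin (fun x => half_solution_dU x S) x12
  (fun y hy => hd y (ltW (proj1 (andP hy)))).
have -> : m * m / k * (x0 + 2 * k / m - (x0 + k / m)) = m.
  by field; rewrite !gt_eqF.
lra.
Qed.

(* Both components double within a time 2 k / m once they exceed m, so they
   would blow up at x0 + 4 k / m. *)
Lemma system_blowup p U V n x0 m k : 1 < p ->
  (forall x, 0 < U x) -> (forall x, 0 < V x) -> system_solution p U V ->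
  0 < k -> (p - 1) * (k * k `^ (p - 1)) = 1 ->
  0 < m -> m <= U x0 -> m <= V x0 -> 0 <= derive1 U x0 -> 0 <= derive1 V x0 ->
  2 ^+ n * m <= U (x0 + 4 * k / m).
Proof.
move=> p1 U0 V0 [SU SV] k0 ek; elim: n x0 m => [|n IH] x0 m m0 mU mV dU dV.
  rewrite expr0 mul1r; apply: le_trans mU _.
  apply: (Dle (fun x => half_solution_dU x SU)).
    by rewrite lerDl !(mulr_ge0, invr_ge0)// ltW.
  by move=> y /andP[/ltW yx _]; exact: half_solution_dU_ge0 p1 U0 SU yx dU.
have mono (f g : R -> R) x : half_solution p f g -> (forall x, 0 < f x) ->
    0 <= derive1 f x0 -> m <= f x0 -> x0 <= x -> m <= f x.
  move=> S f0 df mf xx; apply: le_trans mf _.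
  apply: (Dle (fun x => half_solution_dU x S) xx) => y /andP[/ltW yx _].
  exact: half_solution_dU_ge0 p1 f0 S yx df.
have dU2 := half_solution_double p1 U0 SU k0 ek m0
  (fun x h => mono V U x SV V0 dV mV h) mU dU.
have dV2 := half_solution_double p1 V0 SV k0 ek m0
  (fun x h => mono U V x SU U0 dU mU h) mV dV.
have xx : x0 <= x0 + 2 * k / m by rewrite lerDl !(mulr_ge0, invr_ge0)// ltW.
have := IH (x0 + 2 * k / m) (2 * m) _ dU2 dV2
  (half_solution_dU_ge0 p1 U0 SU xx dU) (half_solution_dU_ge0 p1 V0 SV xx dV).
rewrite mulr_gt0// => /(_ isT).
(* The doubling times form a geometric series, so the final point does not depend on n. *)
have -> : x0 + 2 * k / m + 4 * k / (2 * m) = x0 + 4 * k / m.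
  by field; rewrite gt_eqF.
by rewrite exprSr mulrA.
Qed.

Lemma system_not_both_ge0 p U V x0 : 1 < p ->
  (forall x, 0 < U x) -> (forall x, 0 < V x) -> system_solution p U V ->
  0 <= derive1 U x0 -> 0 <= derive1 V x0 -> False.
Proof.
move=> p1 U0 V0 S dU dV.
have q0 : 0 < p - 1 by rewrite subr_gt0.
(* The solution of (p - 1) k^p = 1 required by [half_solution_double]. *)
pose k := ((p - 1)^-1) `^ p^-1.
have k0 : 0 < k by rewrite powR_gt0 ?invr_gt0.
have ek : (p - 1) * (k * k `^ (p - 1)) = 1.
  rewrite -pow1p// subrK /k pow_invr ?mulfV ?gt_eqF ?invr_ge0 ?(ltW q0)//.
  exact: lt_trans p1.
pose m := Num.min (U x0) (V x0).
have m0 : 0 < m by rewrite lt_min U0 V0.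
have mU : m <= U x0 by rewrite ge_min lexx.
have mV : m <= V x0 by rewrite ge_min lexx orbT.
have := archi_boundP (divr_ge0 (ltW (U0 (x0 + 4 * k / m))) (ltW m0)).
set n := Num.bound _ => hn.
have h := system_blowup n p1 U0 V0 S k0 ek m0 mU mV dU dV.
have : (n%:R : R) <= 2 ^+ n by rewrite -natrX ler_nat ltnW// ltn_expl.
move=> /(lt_le_trans hn); rewrite ltr_pdivrMr// => h2.
by have := lt_le_trans h2 h; rewrite ltxx.
Qed.

(** The flux is odd in the derivative, so reflection changes its sign and preserves the equation. *)
Lemma half_solution_flip p U V : half_solution p U V ->
  half_solution p (fun x => U (- x)) (fun x => V (- x)).
Proof.
move=> [[dU cU] dF eq].
have d1 x : D (fun x => U (- x)) x (- derive1 U (- x)).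
  exact: Dflip (derD (dU (- x))).
have e1 : derive1 (fun x => U (- x)) = fun x => - derive1 U (- x).
  by apply/funext => x; exact: Dder (d1 x).
have e2 : flux p (fun x => U (- x)) (fun x => U (- x)) = fun x => - flux p U U (- x).
  by apply/funext => x; rewrite /flux e1 normrN mulrN.
have d2 x : D (fun x => - flux p U U (- x)) x (derive1 (flux p U U) (- x)).
  by apply: Deq (Dopp (Dflip (derD (dF (- x))))) _; rewrite opprK.
split.
- split; first by move=> x; case: (d1 x).
  rewrite e1 => x; apply: (@cvgN _ _ _ _ _ (fun x => derive1 U (- x))).
  apply: (@continuous_comp _ _ _ (fun x => - x) (derive1 U)); last exact: cU.
  exact: Dcont (Dopp (Did x)).
- by move=> x; rewrite e2; case: (d2 x).
- by move=> x; rewrite /plap e2 (Dder (d2 x)) -eq.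
Qed.

Lemma system_flip p U V : system_solution p U V ->
  system_solution p (fun x => U (- x)) (fun x => V (- x)).
Proof. by move=> [h1 h2]; split; exact: half_solution_flip. Qed.

Lemma system_not_both_le0 p U V x0 : 1 < p ->
  (forall x, 0 < U x) -> (forall x, 0 < V x) -> system_solution p U V ->
  derive1 U x0 <= 0 -> derive1 V x0 <= 0 -> False.
Proof.
move=> p1 U0 V0 S dU dV; have [SU SV] := S.
apply: (system_not_both_ge0 (x0 := - x0) p1 _ _ (system_flip S)) => //.
- by rewrite (Dder (Dflip (half_solution_dU _ SU))) opprK oppr_ge0.
- by rewrite (Dder (Dflip (half_solution_dU _ SV))) opprK oppr_ge0.
Qed.

(** Nonnegative derivatives persist to the right. So V' >= 0 at some x >= 0 would meet U' >= 0
    there, and at some x <= 0 it would persist up to 0, where U' > 0; both are excluded. *)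
Lemma system_signs p U V : 1 < p ->
  (forall x, 0 < U x) -> (forall x, 0 < V x) -> system_solution p U V ->
  0 < derive1 U 0 -> forall x, 0 < derive1 U x /\ derive1 V x < 0.
Proof.
move=> p1 U0 V0 S h0.
have ge0 x := system_not_both_ge0 (x0 := x) p1 U0 V0 S.
have le0 x := system_not_both_le0 (x0 := x) p1 U0 V0 S.
have [SU SV] := S.
have V'0 : derive1 V 0 < 0.
  by rewrite ltNge; apply/negP => h; exact: ge0 (ltW h0) h.
have sU x : derive1 V x < 0 -> 0 < derive1 U x.
  by move=> h; rewrite ltNge; apply/negP => h'; exact: le0 h' (ltW h).
suff sV x : derive1 V x < 0 by move=> x; split => //; exact: sU.
rewrite ltNge; apply/negP => h; case/orP: (le_total 0 x) => x0.
  by apply: ge0 h; exact: half_solution_dU_ge0 p1 U0 SU x0 (ltW h0).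
by move: V'0; rewrite ltNge (half_solution_dU_ge0 p1 V0 SV x0 h).
Qed.

Lemma system_msol_of_gt0 p U V : 1 < p ->
  (forall x, 0 < U x) -> (forall x, 0 < V x) -> system_solution p U V ->
  0 < derive1 U 0 -> msol (p - 1) U V (derive1 U) (fun x => - derive1 V x).
Proof.
move=> p1 U0 V0 S h0; have sg := system_signs p1 U0 V0 S h0.
have [SU SV] := S; have q0 : 0 < p - 1 by rewrite subr_gt0.
have ep (f : R -> R) x : (forall x, 0 < f x) -> f x `^ p = f x * f x `^ (p - 1).
  by move=> f0; rewrite -pow1p ?subrK.
have P0 x : 0 < derive1 U x by case: (sg x).
have Q0 x : 0 < - derive1 V x by rewrite oppr_gt0; case: (sg x).
have eP : flux p U U = fun x => derive1 U x `^ (p - 1).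
  by apply/funext => x; rewrite /flux flux_ge0E// ltW.
have eQ : flux p V V = fun x => - (- derive1 V x) `^ (p - 1).
  by apply/funext => x; rewrite /flux flux_le0E// -oppr_ge0 ltW.
have dP x := half_solution_dF x p1 SU; have dQ x := half_solution_dF x p1 SV.
rewrite eP in dP; rewrite eQ in dQ.
(* The equations only differentiate the q-th powers of P and Q, with q = p - 1; positivity allows
   taking the q-th root, so P and Q are differentiable themselves. *)
have root (f : R -> R) l x : (forall x, 0 < f x) ->
    D (fun x => f x `^ (p - 1)) x ((p - 1) * l) -> D f x (l * f x / f x `^ (p - 1)).
  move=> f0 df.
  have ef : f = fun x => (f x `^ (p - 1)) `^ (p - 1)^-1.
    by apply/funext => y; rewrite pow_inv ?gt_eqF// ltW.
  suff : D (fun x => (f x `^ (p - 1)) `^ (p - 1)^-1) x (l * f x / f x `^ (p - 1)).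
    by rewrite -ef.
  apply: Deq (Dpow (f := fun x => f x `^ (p - 1)) (p - 1)^-1 (powR_gt0 _ (f0 x)) df) _.
  rewrite pow_inv ?gt_eqF ?(ltW (f0 x))//.
  by field; rewrite !gt_eqF ?powR_gt0.
split => //.
- by move=> x; exact: half_solution_dU SU.
- by move=> x; rewrite opprK; exact: half_solution_dU SV.
- move=> x; apply: Deq (root _ _ x P0 (dP x)) _.
  by rewrite ep.
- move=> x; have h := Dopp (dQ x).
  have e : (fun y => - - (- derive1 V y) `^ (p - 1)) = fun y => (- derive1 V y) `^ (p - 1).
    by apply/funext => y; rewrite opprK.
  rewrite e -mulrN in h; apply: Deq (root _ _ x Q0 h) _.
  by rewrite ep// !mulNr.
Qed.

Lemma system_msol p U V : 1 < p ->
  (forall x, 0 < U x) -> (forall x, 0 < V x) -> system_solution p U V ->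
  msol (p - 1) U V (derive1 U) (fun x => - derive1 V x) \/
  msol (p - 1) V U (derive1 V) (fun x => - derive1 U x).
Proof.
move=> p1 U0 V0 S; have [SU SV] := S.
case: (ltrP 0 (derive1 U 0)) => h; first by left; exact: system_msol_of_gt0.
right; apply: system_msol_of_gt0 => //.
by rewrite ltNge; apply/negP => h'; exact: system_not_both_le0 p1 U0 V0 S h h'.
Qed.

End Reduction.

(** * Conclusion *)

Section Conclusion.
Context {R : realType}.
Implicit Types (p q T x : R) (U V P Q phi psi : R -> R).

Lemma half_linearized_derivs p U V phi psi x : half_linearized p U V phi psi ->
  D phi x (derive1 phi x) /\ D (flux p U phi) x
    ((p - 1) * U x `^ (p - 2) * V x `^ p * phi x
     + p * V x `^ (p - 1) * U x `^ (p - 1) * psi x).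
Proof. by case=> h1 h2 h3; split; [exact: derD|apply: Deq (derD (h2 x)) _]. Qed.

Lemma linearized_lsol q U V phi psi :
  msol q U V (derive1 U) (fun x => - derive1 V x) ->
  bounded_fun phi -> bounded_fun psi ->
  linearized_solution (q + 1) U V phi psi ->
  exists k A B, lsol q (derive1 U) (fun x => - derive1 V x) k
    (fun x => phi x / derive1 U x) (fun x => - psi x / - derive1 V x) A B.
Proof.
move=> S bphi bpsi [L1 L2].
pose P := derive1 U; pose Q x := - derive1 V x.
rewrite -/P -/Q in S *.
have q0 := msol_q S; have U0 := msol_U S; have V0 := msol_V S.
have P0 := msol_P S; have Q0 := msol_Q S.
have Pn x : P x != 0 by rewrite gt_eqF.
have Qn x : Q x != 0 by rewrite gt_eqF.
have q1 : q + 1 - 1 = q by ring.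
have q2 : q + 1 - 2 = q - 1 by ring.
have fP x : flux (q + 1) U phi x = P x `^ q / P x * derive1 phi x.
  by rewrite /flux -/(P x) gtr0_norm// q2 pow1m.
have fQ x : flux (q + 1) V psi x = Q x `^ q / Q x * derive1 psi x.
  by rewrite /flux -normrN -/(Q x) gtr0_norm// q2 pow1m.
have dphi x : D phi x (derive1 phi x) by have [] := half_linearized_derivs x L1.
have dpsi x : D psi x (derive1 psi x) by have [] := half_linearized_derivs x L2.
have dfP x : D (flux (q + 1) U phi) x (q * (U x `^ q / U x) * (V x * V x `^ q) * phi x
    + (q + 1) * V x `^ q * U x `^ q * psi x).
  have [_ h] := half_linearized_derivs x L1.
  by apply: Deq h _; rewrite q1 q2 pow1m// pow1p.
have dfQ x : D (flux (q + 1) V psi) x (q * (V x `^ q / V x) * (U x * U x `^ q) * psi x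
    + (q + 1) * U x `^ q * V x `^ q * phi x).
  have [_ h] := half_linearized_derivs x L2.
  by apply: Deq h _; rewrite q1 q2 pow1m// pow1p.
(* Here V^p U^q is P' P^(q-1), so A is P^p times the derivative of phi / P; B is obtained likewise
   from - psi / Q. *)
pose A x := P x * flux (q + 1) U phi x - phi x * (V x * V x `^ q * U x `^ q).
pose B x := - (Q x * flux (q + 1) V psi x) - psi x * (U x * U x `^ q * V x `^ q).
have nz x : [/\ U x != 0, V x != 0, P x `^ q != 0 & Q x `^ q != 0].
  by rewrite !gt_eqF ?powR_gt0.
(* Since (U', V') itself solves the linearized system, the diagonal terms cancel in A' and leave p
   U^q V^q (P psi + Q phi), which is k (a - b) for this k. *)
exists (fun x => (q + 1) * (V x `^ q * U x `^ q * P x * Q x)), A, B; split.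
- by move=> x; rewrite !mulr_gt0 ?powR_gt0 ?addr_gt0.
- move=> x; apply: Deq (Ddiv (Pn x) (dphi x) (msol_dP S x)) _.
  have [n1 n2 n3 n4] := nz x; have n5 := Pn x; have n6 := Qn x.
  rewrite /A fP; move: n1 n2 n3 n4 n5 n6; move: (U x `^ q) (V x `^ q) (P x `^ q) (Q x `^ q).
  move: (U x) (V x) (P x) (Q x) (phi x) (psi x) (derive1 phi x) (derive1 psi x).
  move=> u v r w f g f1 g1 uq vq rq wq n1 n2 n3 n4 n5 n6.
  by field; rewrite n3 n5.
- move=> x; apply: Deq (Ddiv (Qn x) (Dopp (dpsi x)) (msol_dQ S x)) _.
  have [n1 n2 n3 n4] := nz x; have n5 := Qn x; have n6 := Pn x.
  rewrite /B fQ; move: n1 n2 n3 n4 n5 n6; move: (U x `^ q) (V x `^ q) (P x `^ q) (Q x `^ q).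
  move: (U x) (V x) (P x) (Q x) (phi x) (psi x) (derive1 phi x) (derive1 psi x).
  move=> u v r w f g f1 g1 uq vq rq wq n1 n2 n3 n4 n5 n6.
  by field; rewrite n4 n5.
- move=> x; apply: Deq (Dsub (Dmul (msol_dP S x) (dfP x)) (Dmul (dphi x)
    (Dmul (Dmul (msol_dV S x) (msol_dVq S x)) (msol_dUq S x)))) _.
  have [n1 n2 n3 n4] := nz x; have n5 := Pn x; have n6 := Qn x.
  rewrite fP /= -/(P x) -/(Q x); move: n1 n2 n3 n4 n5 n6; move: (U x `^ q) (V x `^ q) (P x `^ q) (Q x `^ q).
  move: (U x) (V x) (P x) (Q x) (phi x) (psi x) (derive1 phi x) (derive1 psi x).
  move=> u v r w f g f1 g1 uq vq rq wq n1 n2 n3 n4 n5 n6.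
  by field; rewrite n1 n2 n3 n5 n6.
- move=> x; apply: Deq (Dsub (Dopp (Dmul (msol_dQ S x) (dfQ x))) (Dmul (dpsi x)
    (Dmul (Dmul (msol_dU S x) (msol_dUq S x)) (msol_dVq S x)))) _.
  have [n1 n2 n3 n4] := nz x; have n5 := Pn x; have n6 := Qn x.
  rewrite fQ /= -/(P x) -/(Q x); move: n1 n2 n3 n4 n5 n6; move: (U x `^ q) (V x `^ q) (P x `^ q) (Q x `^ q).
  move: (U x) (V x) (P x) (Q x) (phi x) (psi x) (derive1 phi x) (derive1 psi x).
  move=> u v r w f g f1 g1 uq vq rq wq n1 n2 n3 n4 n5 n6.
  by field; rewrite n1 n2 n4 n5 n6.
have bnd (f : R -> R) : bounded_fun f -> exists M, forall x, `|f x| <= M.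
  (* [bounded_fun] yields a bound only for constants strictly above M. *)
  by move=> [M [_ HM]]; exists (M + 1) => x; apply: HM => //; rewrite ltrDl.
have [M1 H1] := bnd _ bphi; have [M2 H2] := bnd _ bpsi.
exists (Num.max M1 M2) => x; rewrite !normrM !normfV !(gtr0_norm (P0 x)).
rewrite -/(Q x) (gtr0_norm (Q0 x)) normrN !divfK// !le_max H1 H2 orbT.
by [].
Qed.

Lemma msol_nondegenerate q U V :
  msol q U V (derive1 U) (fun x => - derive1 V x) -> linear_nondegeneracy (q + 1) U V.
Proof.
move=> S phi psi bphi bpsi L.
have [k [A [B H]]] := linearized_lsol S bphi bpsi L.
have [c Hc] := lsol_const S H.
exists c => x; have [h1 h2] := Hc x.
have Pn : derive1 U x != 0 by rewrite gt_eqF// (msol_P S).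
have Qn : derive1 V x != 0 by rewrite -oppr_eq0 gt_eqF// (msol_Q S).
split; first by rewrite -h1 divfK.
by rewrite -h2 invrN mulrNN divfK.
Qed.

Lemma msol_gaussian q U V P Q : msol q U V P Q -> gaussian_decay +oo V Q.
Proof.
move=> S; have [m [M [k [K [c [C [A [h1 h2 h3 h4]]]]]]]] := msol_V_decay S.
exists m, M, k, K, c, C; split => //; split => //; split => //.
near=> x; apply: h4; near: x.
by apply: nbhs_pinfty_ge; exact: num_real.
Unshelve. all: by end_near. Qed.

Lemma gaussian_decay_flip (f df : R -> R) :
  gaussian_decay +oo (fun x => f (- x)) (fun x => df (- x)) -> gaussian_decay -oo f df.
Proof.
case=> m [M [k [K [c [C [h1 [h2 [h3 [X [_ h4]]]]]]]]]].
exists m, M, k, K, c, C; split => //; split => //; split => //.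
exists (- X); split; first exact: num_real.
move=> x xX; have := h4 (- x); rewrite ltrNr => /(_ xX).
by rewrite opprK sqrrN normrN.
Qed.

Lemma msol_derive1U q U V P Q : msol q U V P Q -> derive1 U = P.
Proof. by move=> S; apply/funext => x; exact: Dder (msol_dU S x). Qed.

Lemma msol_derive1V q U V P Q : msol q U V P Q -> derive1 V = fun x => - Q x.
Proof. by move=> S; apply/funext => x; exact: Dder (msol_dV S x). Qed.

Lemma msol_Q_cvg q U V P Q T : msol q U V P Q -> (forall x,
  P x * P x `^ q + Q x * Q x `^ q - U x * U x `^ q * (V x * V x `^ q) = T) ->
  - Q x @[x --> -oo] --> - (T `^ (q + 1)^-1).
Proof.
move=> S ET; apply: cvgN; apply/cvgNy_compNP.
apply: (proj2 (msol_P_cvg (msol_flip S) _)) => x.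
by rewrite -(ET (- x)) /=; ring.
Qed.

Lemma msol_asymptotics q U V P Q T : msol q U V P Q -> (forall x,
  P x * P x `^ q + Q x * Q x `^ q - U x * U x `^ q * (V x * V x `^ q) = T) ->
  asymptotics (q + 1) T U V.
Proof.
move=> S ET; rewrite /asymptotics (msol_derive1U S) (msol_derive1V S).
have -> : (fun x => - (- Q x)) = Q by apply/funext => x; rewrite opprK.
split; split.
- exact: msol_P S.
- exact: proj2 (msol_P_cvg S ET).
- by apply: gaussian_decay_flip; exact: msol_gaussian (msol_flip S).
- by move=> x; rewrite oppr_lt0 (msol_Q S).
- exact: msol_Q_cvg S ET.
- exact: msol_gaussian S.
Qed.

Lemma msol_energyE q U V P Q T : msol q U V P Q -> (forall x,
  P x * P x `^ q + Q x * Q x `^ q - U x * U x `^ q * (V x * V x `^ q) = T) ->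
  forall x, energy (q + 1) U V x = T.
Proof.
move=> S ET x; rewrite -(ET x) /energy (msol_derive1U S) (msol_derive1V S) normrN.
rewrite (gtr0_norm (msol_P S x)) (gtr0_norm (msol_Q S x)).
by rewrite !pow1p// ?(msol_U S) ?(msol_V S) ?(msol_P S) ?(msol_Q S).
Qed.

Lemma energy_swap p U V x : energy p U V x = energy p V U x.
Proof.
rewrite /energy; move: (`|derive1 U x| `^ p) (`|derive1 V x| `^ p) => a b.
by rewrite (mulrC (U x `^ p)) (addrC a).
Qed.

(** The sign of T is recorded so that the limit of U' is a genuine p-th root. *)
Lemma msol_main q U V :
  msol q U V (derive1 U) (fun x => - derive1 V x) ->
  exists T, [/\ forall x, energy (q + 1) U V x = T, 0 <= T &
    [/\ reflected U V, asymptotics (q + 1) T U V &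
        linear_nondegeneracy (q + 1) U V]].
Proof.
move=> S; have [T ET] := msol_energy S; have [T0 _] := msol_P_cvg S ET.
exists T; split; [exact: msol_energyE S ET|exact: ltW|split => //].
- exact: msol_reflected S.
- exact: msol_asymptotics S ET.
- exact: msol_nondegenerate.
Qed.

End Conclusion.

Theorem theorem1p2 (R : realType) (p : R) (U V : R -> R)
    (hp : 1 < p)
    (hU : forall x, 0 < U x) (hV : forall x, 0 < V x)
    (hUV : system_solution p U V) :
  exists T : R,
    [/\ forall x, energy p U V x = T, 0 <= T &
        [/\ reflected U V, asymptotics p T U V & linear_nondegeneracy p U V] \/
        [/\ reflected V U, asymptotics p T V U & linear_nondegeneracy p V U]].
Proof.
case: (system_msol hp hU hV hUV) => /msol_main; rewrite subrK => -[T [ET T0 H]].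
  by exists T; split => //; left.
by exists T; split => //; [move=> x; rewrite energy_swap|right].
Qed.
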